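(* Let $\Omega^\pm \subseteq \mathbb{R}^d$ be open convex sets and let $\mu^\pm$ be absolutely continuous probability measures with $L^\infty$ densities, compactly supported in $\Omega^\pm$ respectively. Assume that the cost $c$ is $\mathscr{C}^2$ on $\Omega^- \times \Omega^+$ and infinitesimally twisted. Then, as $\varepsilon \downarrow 0$, \[ v_\varepsilon = v_0 + \frac{d}{2}\varepsilon \log(1/\varepsilon)+ O(\varepsilon). \]
   Context: Let $X^\pm = \operatorname{spt}\mu^\pm$ and let $\Pi(\mu^-,\mu^+)$ be the set of probability measures on $X^-\times X^+$ with marginals $\mu^-$ and $\mu^+$. For probability measures $p,q$, the relative entropy is $\mathrm{Ent}(p\,|\,q)=\int \rho\log\rho\,\mathrm{d}q$ if $p=\rho q$, and $+\infty$ otherwise. For $\varepsilon>0$, \[v_\varepsilon \coloneqq \inf_{\gamma\in\Pi(\mu^-,\mu^+)}\Big\{\int c\,\mathrm{d}\gamma + \varepsilon\,\mathrm{Ent}(\gamma\,|\,\mu^-\otimes\mu^+)\Big\},\qquad v_0\coloneqq \inf_{\gamma\in\Pi(\mu^-,\mu^+)}\int c\,\mathrm{d}\gamma.\] A cost $c\in\mathscr{C}^2(\Omega^-\times\Omega^+)$ is infinitesimally twisted if the matrix $\nabla^2_{xy}c(x,y)=(\partial^2_{x_iy_j}c(x,y))_{i,j}$ is invertible for every $(x,y)\in\Omega^-\times\Omega^+$. *)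

(* Defs.v *)
From HB Require Import structures.
From mathcomp Require Import all_boot all_order all_algebra.
From mathcomp Require Import all_classical all_reals all_analysis.
Set Implicit Arguments. Unset Strict Implicit. Unset Printing Implicit Defensive.
Import Order.TTheory GRing.Theory Num.Theory.
Import numFieldNormedType.Exports.
Local Open Scope classical_set_scope.
Local Open Scope ring_scope.

Section BorelRd.
Context (R : realType) (n : nat).

Definition borel_rV : set (set 'rV[R]_n) := <<s [set A | open A] >>.

Let borel_rV0 : borel_rV set0.
Proof. exact: sigma_algebra0. Qed.
Let borel_rVC A : borel_rV A -> borel_rV (~` A).
Proof. exact: sigma_algebraC. Qed.
Let borel_rV_bigcup (F : (set 'rV[R]_n)^nat) :
  (forall i, borel_rV (F i)) -> borel_rV (\bigcup_i F i).
Proof. exact: sigma_algebra_bigcup. Qed.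

HB.instance Definition _ := @isMeasurable.Build default_measure_display
  'rV[R]_n borel_rV borel_rV0 borel_rVC borel_rV_bigcup.
End BorelRd.

Section Defs.
Context (R : realType).
Local Open Scope ereal_scope.

Definition vcons (n : nat) (a : R) (t : 'rV[R]_n) : 'rV[R]_n.+1 :=
  \row_(i < n.+1) match unlift ord0 i with Some j => t ord0 j | None => a end.

(* Lebesgue integral on R^n of a (nonnegative, Borel) function, written as *)
(* the iterated integral w.r.t. the one-dimensional Lebesgue measure      *)
(* (equal to the integral against d-dimensional Lebesgue measure by        *)
(* Tonelli's theorem).                                                     *)
Fixpoint leb_int (n : nat) : ('rV[R]_n -> \bar R) -> \bar R :=
  match n as n0 return ('rV[R]_n0 -> \bar R) -> \bar R with
  | 0 => fun F => F 0%R
  | n'.+1 => fun F =>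
      \int[@lebesgue_measure R]_a leb_int (fun t => F (vcons a t))
  end.

Definition abs_cont_Linf (d : nat) (mu : set 'rV[R]_d -> \bar R) :=
  exists f : 'rV[R]_d -> R,
    [/\ measurable_fun setT f,
        (exists M : R, forall x, (0 <= f x <= M)%R) &
        forall A, measurable A ->
          mu A = leb_int (fun x => ((f x) * (\1_A x : R))%:E)].

Definition spt (d : nat) (mu : set 'rV[R]_d -> \bar R) : set 'rV[R]_d :=
  [set x | forall r : R, (0 < r)%R -> 0 < mu (ball x r)].

Definition evec (d : nat) (i : 'I_d) : 'rV[R]_d := delta_mx ord0 i.

Definition Dx (d : nat) (i : 'I_d) (g : 'rV[R]_d -> 'rV[R]_d -> R) :=
  fun x y => 'D_(evec i) (fun x' => g x' y) x.
Definition Dy (d : nat) (i : 'I_d) (g : 'rV[R]_d -> 'rV[R]_d -> R) :=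
  fun x y => 'D_(evec i) (g x) y.

Definition cont_on (d : nat) (Om Op : set 'rV[R]_d)
  (g : 'rV[R]_d -> 'rV[R]_d -> R) :=
  forall x y, Om x -> Op y ->
    (fun z : 'rV[R]_d * 'rV[R]_d => g z.1 z.2) @ (x, y) --> g x y.

Definition C1_on (d : nat) (Om Op : set 'rV[R]_d)
  (g : 'rV[R]_d -> 'rV[R]_d -> R) :=
  [/\ cont_on Om Op g,
      forall i x y, Om x -> Op y ->
        derivable (fun x' => g x' y) x (evec i) /\ derivable (g x) y (evec i),
      forall i, cont_on Om Op (Dx i g) &
      forall i, cont_on Om Op (Dy i g)].

Definition C2_on (d : nat) (Om Op : set 'rV[R]_d)
  (g : 'rV[R]_d -> 'rV[R]_d -> R) :=
  C1_on Om Op g /\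
  forall i, C1_on Om Op (Dx i g) /\ C1_on Om Op (Dy i g).

Definition mixed_hessian (d : nat) (c : 'rV[R]_d -> 'rV[R]_d -> R)
  (x y : 'rV[R]_d) : 'M[R]_d :=
  \matrix_(i < d, j < d) Dx i (Dy j c) x y.

Definition inf_twisted (d : nat) (Om Op : set 'rV[R]_d)
  (c : 'rV[R]_d -> 'rV[R]_d -> R) :=
  forall x y, Om x -> Op y -> mixed_hessian c x y \in unitmx.

Definition coupling (d : nat) (mum mup : probability 'rV[R]_d R)
  (g : probability ('rV[R]_d * 'rV[R]_d)%type R) :=
  [/\ g (~` (spt mum `*` spt mup)) = 0,
      forall A, measurable A -> g (A `*` setT) = mum A &
      forall B, measurable B -> g (setT `*` B) = mup B].

(* relative entropy Ent(g | mum (x) mup) : the integral of rho log rho for *)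
(* a density rho of g w.r.t. mum (x) mup, and +oo if there is none        *)
(* (all densities agree a.e., hence the infimum is just that value).      *)
Definition rel_ent (d : nat) (mum mup : probability 'rV[R]_d R)
  (g : probability ('rV[R]_d * 'rV[R]_d)%type R) : \bar R :=
  ereal_inf [set \int[mum \x mup]_z ((rho z) * ln (rho z))%:E
            | rho in [set rho : 'rV[R]_d * 'rV[R]_d -> R |
                 [/\ measurable_fun setT rho,
                     forall z, (0 <= rho z)%R &
                     forall A, measurable A ->
                       g A = \int[mum \x mup]_(z in A) (rho z)%:E]]].

Definition transport_cost (d : nat) (Om Op : set 'rV[R]_d)
  (c : 'rV[R]_d -> 'rV[R]_d -> R)
  (g : probability ('rV[R]_d * 'rV[R]_d)%type R) : \bar R :=
  \int[g]_(z in Om `*` Op) (c z.1 z.2)%:E.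

Definition v_eps (d : nat) (Om Op : set 'rV[R]_d)
  (mum mup : probability 'rV[R]_d R) (c : 'rV[R]_d -> 'rV[R]_d -> R)
  (eps : R) : \bar R :=
  ereal_inf [set transport_cost Om Op c g + eps%:E * rel_ent mum mup g
            | g in [set g | coupling mum mup g]].

Definition v_0 (d : nat) (Om Op : set 'rV[R]_d)
  (mum mup : probability 'rV[R]_d R) (c : 'rV[R]_d -> 'rV[R]_d -> R)
  : \bar R :=
  ereal_inf [set transport_cost Om Op c g | g in [set g | coupling mum mup g]].

End Defs.

(* Main.v *)
Require Import Defs.
From HB Require Import structures.
From mathcomp Require Import all_boot all_order all_algebra.
From mathcomp Require Import all_classical all_reals all_analysis.
From mathcomp Require Import measurable_realfun.
From mathcomp Require Import ring lra.
Set Implicit Arguments. Unset Strict Implicit. Unset Printing Implicit Defensive.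
Import Order.TTheory GRing.Theory Num.Theory.
Import numFieldNormedType.Exports.
Local Open Scope classical_set_scope.
Local Open Scope ring_scope.

(* Let [D] be the cross difference [c x y + c x' y' - c x y' - c x' y].  Write the
   mixed Hessian near a point as [H] and put [u = x + H y], [v = x - H y]: then
   [D] is [(|u - u'|^2 - |v - v'|^2) / 4] up to a small relative error (Minty's
   trick), so on a set of pairs where [D <= 2 del^2], [u] is Lipschitz in [v] at
   scale [del].  Hence [C / del^d] labels, depending on [del] only, split every
   such set into pieces of diameter [O(del)].

   Both inequalities use this with [del^2] of order [eps], after replacing the
   marginals by finite partitions much finer than [eps] requires; potentials
   [phi], [psi] come from finite-dimensional duality and the slack is
   [E = c - phi - psi >= 0], so that [D <= E + E'].

   Upper bound: split an optimal discrete plan into the pieces above and replace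
   each piece by the product of its marginals.  The cost grows by [O(del^2)], and
   the entropy of the result is at most the entropy of the label, i.e.
   [d ln (1 / del) + O(1)].

   Lower bound: Gibbs' inequality gives
   [v_eps >= v_0 - eps ln Z - O(eps)] with [Z] the integral of [exp (- E / eps)];
   the set [E <= del^2] has [O(del^-d)] pieces, each of mass [O(del^(2d))] since
   the densities are bounded, and summing over levels gives [Z = O(eps^(d/2))]. *)

(** * Duality for finite transport problems *)

Lemma continuous_sum_fin (X : topologicalType) (R : realType) (T : finType)
  (F : T -> X -> R) :
  (forall t, continuous (F t)) -> continuous (fun x => \sum_t F t x).
Proof.
by move=> Fc; apply: (continuous_big (@add_continuous R)) => t _; exact: Fc.
Qed.

(** A closed subset of the cube [[0, 1]^T], which is compact by Tychonoff; hence the product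
    topology on functions. *)
Lemma compact_simplex (R : realType) (T : finType) :
  compact ([set g | (forall t, 0 <= g t) /\ \sum_t g t = 1] :
    set (prod_topology (fun _ : T => R))).
Proof.
set P := prod_topology (fun _ : T => R).
have cK : compact [set g : P | forall t, `[0, 1]%classic (g t)].
  by apply: (@tychonoff T (fun _ => R) (fun _ => `[0, 1]%classic)) => t; exact: segment_compact.
apply: (subclosed_compact _ cK); last first.
  move=> g [g0 g1] t /=; rewrite in_itv /= g0 /= -g1 (bigD1 t) //= lerDl.
  by apply: sumr_ge0 => s _; exact: (g0 s).
rewrite (_ : [set g | _] =
   (\bigcap_t [set g : P | 0 <= g t]) `&` [set g : P | \sum_t g t = 1]); last first.
  by apply/seteqP; split => [g [g0 g1]|g [g0 g1]]; split => //= t; [move=> _; exact: g0|exact: g0].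
apply: closedI.
  apply: closed_bigI => t _.
  apply: (@preimage_closed P R (fun g : P => g t) [set x | 0 <= x]); last exact: closed_ge.
  by move=> g _; exact: proj_continuous.
apply: (@preimage_closed P R (fun g : P => \sum_t g t) [set x | x = 1]); last exact: closed_eq.
move=> g _; apply: (@continuous_sum_fin P R T (fun t g => g t)) => t; exact: proj_continuous.
Qed.

(* The minimiser of the squared residual on the simplex is the projection used
   to separate [w] from the convex hull of the columns of [l]. *)
Lemma simplex_separation (R : realType) (T K : finType) (t0 : T)
  (l : K -> T -> R) (w : K -> R) :
  (forall g : T -> R, (forall t, 0 <= g t) -> \sum_t g t = 1 ->
     ~ (forall k, \sum_t l k t * g t = w k)) ->
  exists r : K -> R, forall t, 0 < \sum_k r k * (l k t - w k).
Proof.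
move=> nosol; set P := prod_topology (fun _ : T => R).
pose S : set P := [set g | (forall t, 0 <= g t) /\ \sum_t g t = 1].
pose res (g : T -> R) k := \sum_t l k t * g t - w k.
pose J (g : P) : R := \sum_k res g k ^+ 2.
have cJ : continuous J.
  apply: continuous_sum_fin => k g; apply: (@continuousM R P (res ^~ k) (res ^~ k));
  apply: (@continuousB _ _ P (fun g : P => \sum_t l k t * g t) (fun => w k)); try exact: cst_continuous;
  apply: continuous_sum_fin => t {}g; apply: (@continuousM R P (fun=> l k t) (fun g => g t));
    [exact: cst_continuous|exact: proj_continuous|exact: cst_continuous|exact: proj_continuous].
have S0 : S !=set0.
  exists (fun t => (t == t0)%:R); split => [t|]; first by rewrite ler0n.
  by rewrite (bigD1 t0) //= eqxx big1 ?addr0// => i /negPf ->.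
have [g /set_mem[g0 g1] gmin] := compact_EVT_min S0 (@compact_simplex R T)
  (@continuous_subspaceT _ _ _ J cJ).
(* The separating functional is the residual at the projection [g]. Its value at column [t] is
   [a + |r|^2], where [a] pairs [r] with the direction from the projection to that column, so it
   suffices that [a >= 0]. *)
pose r := res g; exists r => t.
have Jpos : 0 < \sum_k r k ^+ 2.
  rewrite lt_neqAle sumr_ge0 ?andbT => [|k _]; last exact: sqr_ge0.
  rewrite eq_sym; apply/negP => /eqP J0; apply: (nosol g) => // k.
  have /eqP : r k ^+ 2 = 0 by apply: (psumr_eq0P _ J0) => // i _; exact: sqr_ge0.
  by rewrite sqrf_eq0 subr_eq0 => /eqP.
pose h k := l k t - \sum_s l k s * g s.
have hE k : l k t - w k = h k + r k by rewrite /h /r /res; ring.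
rewrite (eq_bigr (fun k => r k * h k + r k ^+ 2)); last first.
  by move=> k _; rewrite hE; ring.
rewrite big_split /= ltr_wpDl//.
pose a := \sum_k r k * h k; pose b := \sum_k h k ^+ 2.
have b0 : 0 <= b by apply: sumr_ge0 => k _; exact: sqr_ge0.
(* Moving from [g] towards vertex [t] by a step [s] changes [J] by [s (2 a + s b)], which minimality
   makes nonnegative; were [a] negative, a step with [s b <= - a] would contradict this. *)
have quad s : 0 < s -> s <= 1 -> 0 <= 2 * a + s * b.
  move=> s0 s1.
  pose gs : P := fun u => (1 - s) * g u + s * (u == t)%:R.
  have gsS : gs \in S.
    apply/mem_set; split => [u|].
      apply: addr_ge0; last by rewrite mulr_ge0 ?ler0n// ltW.
      by apply: mulr_ge0; [rewrite subr_ge0|exact: (g0 u)].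
    rewrite big_split /= -!mulr_sumr g1 (bigD1 t) //= eqxx big1 => [|i /negPf ->//].
    by rewrite addr0 !mulr1 subrK.
  have := gmin _ gsS.
  have resE k : res gs k = r k + s * h k.
    rewrite /res (eq_bigr (fun u => (1 - s) * (l k u * g u) + s * (l k u * (u == t)%:R))); last first.
      by move=> u _; rewrite /gs; ring.
    have lt : \sum_u l k u * (u == t)%:R = l k t.
      by rewrite (bigD1 t)//= eqxx mulr1 big1 ?addr0// => i /negPf ->; rewrite mulr0.
    rewrite big_split /= -!mulr_sumr lt.
    by rewrite /r /h /res; ring.
  have -> : J gs = J g + s * (2 * a + s * b).
    rewrite /J /a /b !mulr_sumr -big_split /= mulr_sumr -big_split /=.
    by apply: eq_bigr => k _; rewrite resE /r; ring.
  by rewrite lerDl pmulr_rge0.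
rewrite leNgt; apply/negP => a0.
have b1 : 0 < b + 1 by rewrite ltr_wpDl.
pose s := Num.min 1 (- a / (b + 1)).
have s0 : 0 < s by rewrite lt_min ltr01 divr_gt0 // oppr_gt0.
have s1 : s <= 1 by rewrite ge_min lexx.
have sb : s * b <= - a.
  have : s * (b + 1) <= - a by rewrite -ler_pdivlMr// ge_min lexx orbT.
  by apply: le_trans; apply: ler_wpM2l; [exact: ltW|rewrite lerDl].
have := quad s s0 s1; rewrite leNgt => /negP; apply.
apply: (le_lt_trans (y := 2 * a - a)); first by rewrite lerD2l.
by rewrite (_ : 2 * a - a = a)//; ring.
Qed.

Definition fin_coupling (R : realType) (I J : finType) (a : I -> R) (b : J -> R)
  (g : I -> J -> R) :=
  [/\ forall i j, 0 <= g i j, forall i, \sum_j g i j = a i &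
      forall j, \sum_i g i j = b j].

Lemma fin_coupling_min (R : realType) (I J : finType) (a : I -> R) (b : J -> R)
  (c : I -> J -> R) :
  (forall i, 0 <= a i) -> (forall j, 0 <= b j) ->
  \sum_i a i = 1 -> \sum_j b j = 1 ->
  exists2 g, fin_coupling a b g & forall g', fin_coupling a b g' ->
    \sum_i \sum_j g i j * c i j <= \sum_i \sum_j g' i j * c i j.
Proof.
move=> a0 b0 a1 b1; pose T := (I * J)%type.
set P := prod_topology (fun _ : T => R).
pose K : set P := [set g | fin_coupling a b (fun i j => g (i, j))].
pose cost (g : P) := \sum_i \sum_j g (i, j) * c i j.
have cont_row i : continuous (fun g : P => \sum_j g (i, j)).
  by apply: continuous_sum_fin => j; exact: proj_continuous.
have cont_col j : continuous (fun g : P => \sum_i g (i, j)).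
  by apply: continuous_sum_fin => i; exact: proj_continuous.
have K0 : K !=set0.
  exists (fun t => a t.1 * b t.2); split => [i j|i|j] /=; first exact: mulr_ge0.
    by rewrite -mulr_sumr b1 mulr1.
  by rewrite -mulr_suml a1 mul1r.
have cK : compact K.
  apply: (subclosed_compact _ (@compact_simplex R T)); last first.
    move=> g [g0 ga gb]; split => [[i j]|]; first exact: g0.
    by rewrite -a1 -(eq_bigr _ (fun i _ => ga i)) pair_big /=; apply: eq_bigr => -[].
  rewrite (_ : K = (\bigcap_t [set g : P | 0 <= g t]) `&`
     ((\bigcap_i [set g : P | \sum_j g (i, j) = a i]) `&`
      (\bigcap_j [set g : P | \sum_i g (i, j) = b j]))); last first.
    apply/seteqP; split => [g [g0 ga gb]|g [g0 [ga gb]]].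
      by split => [[i j] _|]; [exact: g0|split => [i _|j _]; [exact: ga|exact: gb]].
    by split => [i j|i|j]; [exact: (g0 (i, j))|exact: (ga i)|exact: (gb j)].
  apply: closedI; [|apply: closedI]; apply: closed_bigI => t _.
  - apply: (@preimage_closed P R (fun g : P => g t) [set x | 0 <= x]); last exact: closed_ge.
    by move=> g _; exact: proj_continuous.
  - apply: (@preimage_closed P R (fun g : P => \sum_j g (t, j)) [set x | x = a t]); last exact: closed_eq.
    by move=> g _; exact: cont_row.
  - apply: (@preimage_closed P R (fun g : P => \sum_i g (i, t)) [set x | x = b t]); last exact: closed_eq.
    by move=> g _; exact: cont_col.
have ccost : continuous cost.
  apply: continuous_sum_fin => i; apply: continuous_sum_fin => j g.
  by apply: (@continuousM R P (fun g => g (i, j)) (fun=> c i j));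
    [exact: proj_continuous|exact: cst_continuous].
have [g /set_mem Kg gmin] := compact_EVT_min K0 cK (@continuous_subspaceT _ _ _ cost ccost).
exists (fun i j => g (i, j)) => // g' Kg'.
by have := gmin (fun t => g' t.1 t.2); apply; apply/mem_set.
Qed.

(** The columns are the triples (indicator of [i], indicator of [j], [c i j]). A coupling of cost
    [v - eta] would express [(a, b, v - eta)] as a convex combination of columns; minimality
    excludes it, and the separating functional, divided by its cost coefficient [q], yields the
    potentials. *)
Lemma fin_coupling_dual (R : realType) (I J : finType) (a : I -> R) (b : J -> R)
  (c : I -> J -> R) (g : I -> J -> R) (eta : R) :
  fin_coupling a b g -> \sum_i a i = 1 -> 0 < eta ->
  (forall g', fin_coupling a b g' ->
    \sum_i \sum_j g i j * c i j <= \sum_i \sum_j g' i j * c i j) ->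
  exists (phi : I -> R) (psi : J -> R), (forall i j, phi i + psi j <= c i j) /\
    \sum_i \sum_j g i j * c i j <= \sum_i a i * phi i + \sum_j b j * psi j + eta.
Proof.
move=> [g0 ga gb] a1 eta0 gmin.
pose T := (I * J)%type; pose K := (I + J + unit)%type.
set v := \sum_i \sum_j g i j * c i j in gmin *.
pose l (k : K) (t : T) : R := match k with
  | inr _ => c t.1 t.2
  | inl (inl i) => (t.1 == i)%:R
  | inl (inr j) => (t.2 == j)%:R end.
pose w (k : K) : R := match k with
  | inr _ => v - eta | inl (inl i) => a i | inl (inr j) => b j end.
have sumK (F : K -> R) : \sum_k F k =
    \sum_i F (inl (inl i)) + \sum_j F (inl (inr j)) + F (inr tt).
  by rewrite !big_sumType /= (big_pred1 tt)// => -[].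
have sumT (F : T -> R) : \sum_t F t = \sum_i \sum_j F (i, j).
  by rewrite pair_big; apply: eq_bigr => -[].
have selE (X : finType) (x : X) (F : X -> R) : \sum_y (y == x)%:R * F y = F x.
  by rewrite (bigD1 x)//= eqxx mul1r big1 ?addr0// => y /negPf ->; rewrite mul0r.
have [i0 _] : exists i0 : I, true.
  have [i _|I0] := pickP I; first by exists i.
  by move/eqP: a1; rewrite big_pred0// eq_sym oner_eq0.
have [j0 _] : exists j0 : J, true.
  have [j _|J0] := pickP J; first by exists j.
  move/eqP: a1; rewrite big1 1?eq_sym ?oner_eq0// => i _.
  by rewrite -ga big_pred0.
have [|r rpos] := @simplex_separation R T K (i0, j0) l w.
  move=> h h0 h1 hw; pose g' i j := h (i, j).
  have g'c : fin_coupling a b g'.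
    split=> [i j|i|j]; first exact: h0.
      have := hw (inl (inl i)); rewrite sumT /= => <-.
      rewrite exchange_big /=; apply: eq_bigr => j _.
      by rewrite (selE _ i (fun i => h (i, j))).
    have := hw (inl (inr j)); rewrite sumT /= => <-.
    by apply: eq_bigr => i _; rewrite (selE _ j (fun j => h (i, j))).
  have := hw (inr tt); rewrite sumT /= => hc.
  have := gmin _ g'c; rewrite (eq_bigr (fun i => \sum_j c i j * h (i, j))); last first.
    by move=> i _; apply: eq_bigr => j _; rewrite mulrC.
  by rewrite hc lerBrDr gerDl leNgt eta0.
pose q := r (inr tt); pose ri i := r (inl (inl i)); pose rj j := r (inl (inr j)).
pose A := \sum_i ri i * a i; pose B := \sum_j rj j * b j.
have {}rpos i j : A + B + q * (v - eta) < ri i + rj j + q * c i j.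
  have := rpos (i, j); rewrite sumK /=.
  under eq_bigr do rewrite mulrBr.
  under [X in _ + X + _]eq_bigr do rewrite mulrBr.
  rewrite !sumrB -/A -/B.
  have -> : \sum_i1 r (inl (inl i1)) * (i == i1)%:R = ri i.
    by under eq_bigr do rewrite mulrC eq_sym; rewrite selE.
  have -> : \sum_j1 r (inl (inr j1)) * (j == j1)%:R = rj j.
    by under eq_bigr do rewrite mulrC eq_sym; rewrite selE.
  by rewrite /q; lra.
have gsum (F : I -> J -> R) (h : R) : (forall i j, h < F i j) ->
    h <= \sum_i \sum_j g i j * F i j.
  move=> hF; have <- : \sum_i \sum_j g i j * h = h.
    under eq_bigr do rewrite -mulr_suml ga.
    by rewrite -mulr_suml a1 mul1r.
  apply: ler_sum => i _; apply: ler_sum => j _.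
  by apply: ler_wpM2l => //; apply/ltW/hF.
have gsplit (f : I -> R) (h : J -> R) (k : I -> J -> R) (x : R) :
    \sum_i \sum_j g i j * (f i + h j + x * k i j) =
    \sum_i f i * a i + \sum_j h j * b j + x * \sum_i \sum_j g i j * k i j.
  under eq_bigr do under eq_bigr do rewrite !mulrDr.
  under eq_bigr do rewrite !big_split /=.
  rewrite !big_split /=; congr (_ + _ + _).
  - by apply: eq_bigr => i _; rewrite -mulr_suml ga mulrC.
  - by rewrite exchange_big; apply: eq_bigr => j _; rewrite -mulr_suml gb mulrC.
  - by rewrite mulr_sumr; apply: eq_bigr => i _; rewrite mulr_sumr; apply: eq_bigr => j _; ring.
(* Averaging [rpos] against [g] gives [q * (v - eta) < q * v]. The average stays strict because some
   [g i j] is positive. *)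
have q0 : 0 < q.
  have qv : A + B + q * (v - eta) < \sum_i \sum_j g i j * (ri i + rj j + q * c i j).
    have [i [j gij]] : exists i j, 0 < g i j.
      apply: contrapT => H; move/eqP: a1; rewrite big1 1?eq_sym ?oner_eq0// => i _.
      rewrite -ga big1// => j _; apply/eqP; rewrite eq_le g0 andbT leNgt.
      by apply/negP => gij; apply: H; exists i, j.
    set h := A + B + _; have hE : h = \sum_i \sum_j g i j * h.
      under eq_bigr do rewrite -mulr_suml ga.
      by rewrite -mulr_suml a1 mul1r.
    rewrite [ltLHS]hE (bigD1 i)//= [ltRHS](bigD1 i)//=.
    apply: ltr_leD; last first.
      apply: ler_sum => i' _; apply: ler_sum => j' _.
      by apply: ler_wpM2l => //; apply/ltW/rpos.
    rewrite (bigD1 j)//= [ltRHS](bigD1 j)//=.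
    apply: ltr_leD; first by rewrite ltr_pM2l.
    by apply: ler_sum => j' _; apply: ler_wpM2l => //; apply/ltW/rpos.
  move: qv; rewrite gsplit -/A -/B -/v ltrD2l mulrBr gtrBl => h.
  by rewrite -(pmulr_lgt0 _ eta0).
(* The constant [(A + B) / q + (v - eta)] can be put into the first potential because [a] has total
   mass one; the dual value is then exactly [v - eta]. *)
exists (fun i => (A + B) / q + (v - eta) - ri i / q), (fun j => - rj j / q); split.
  move=> i j; have := ltW (rpos i j).
  rewrite -subr_ge0 => h; rewrite -subr_ge0; move: h.
  rewrite (_ : ri i + rj j + _ - _ = q * (c i j - ((A + B) / q + (v - eta) - ri i / q + - rj j / q))).
    by rewrite pmulr_rge0.
  by field; rewrite gt_eqF.
under eq_bigr do rewrite mulrBr.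
rewrite sumrB -mulr_suml a1.
rewrite (_ : \sum_i a i * (ri i / q) = A / q); last first.
  by rewrite mulr_suml; apply: eq_bigr => i _; ring.
rewrite (_ : \sum_j b j * (- rj j / q) = - B / q); last first.
  by rewrite /B -sumrN mulr_suml; apply: eq_bigr => i _; ring.
by rewrite mul1r mulrDl mulNr le_eqVlt; apply/orP; left; apply/eqP; ring.
Qed.

(** * The cross difference and Minty's trick *)

(** Near-covering compactness is applied to the filter of conditions met by every large enough set
    satisfying [P], where large enough means containing some fixed set satisfying [P]; stability
    under unions makes this a filter. Labels, finite nets and uniform continuity all become global
    in this way. *)
Lemma compact_induction (T : topologicalType) (K : set T) (P : set T -> Prop) :
  compact K -> P set0 -> (forall A B, P A -> P B -> P (A `|` B)) ->
  (forall A B, A `<=` B -> P B -> P A) ->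
  (forall x, K x -> exists2 U, nbhs x U & P U) -> P K.
Proof.
move=> /compact_near_coveringP cK P0 PU PS Ploc.
pose F : set_system (set T) :=
  [set Q | exists2 A, P A & forall B, P B -> A `<=` B -> Q B].
have FF : Filter F.
  split; first by exists set0.
    move=> Q1 Q2 [A1 PA1 h1] [A2 PA2 h2]; exists (A1 `|` A2); first exact: PU.
    by move=> B PB AB; split; [apply: h1|apply: h2] => // x Ax; apply: AB; [left|right].
  by move=> Q1 Q2 Q12 [A PA h]; exists A => // B PB AB; apply: Q12; exact: h.
have [|A PA] := cK _ F (fun A x => P A /\ A x) FF; last first.
  by move=> /(_ _ PA (@subset_refl _ A)) KA; apply: PS PA => x /KA[].
move=> x /Ploc[U Ux PU0]; exists (U, [set B | P B /\ U `<=` B]) => /=.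
  by split => //; exists U.
by move=> [y B] [/= Uy [PB UB]]; split => //; exact: UB.
Qed.

Lemma ball_rV (R : realType) (d : nat) (x y : 'rV[R]_d) (r : R) : 0 < r ->
  ball x r y <-> (forall j, `|x ord0 j - y ord0 j| < r).
Proof.
move=> r0; split => [[_ h] j|h]; first exact: (h ord0 j).
by split => // i j; rewrite ord1; exact: h.
Qed.

Lemma rV_normP (R : realType) (d : nat) (x : 'rV[R]_d) (r : R) : 0 <= r ->
  `|x| <= r <-> (forall j, `|x ord0 j| <= r).
Proof.
move=> r0; split => [h j|h].
  apply: le_trans h; rewrite /Num.norm /= mx_normrE.
  exact: (le_bigmax _ (fun i : 'I_1 * 'I_d => `|x i.1 i.2|) (ord0, j)).
rewrite /Num.norm /= mx_normrE; apply: bigmax_le => // -[i j] _ /=.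
by rewrite ord1.
Qed.

Lemma coord_le_norm (R : realType) (d : nat) (x : 'rV[R]_d) j : `|x ord0 j| <= `|x|.
Proof. by move: j; apply/rV_normP. Qed.

Lemma is_derive_line (R : realType) (d : nat) (g : 'rV[R]_d -> R) (x v : 'rV[R]_d) (t : R) :
  derivable g (x + t *: v) v ->
  is_derive t 1 (fun s => g (x + s *: v)) ('D_v g (x + t *: v)).
Proof.
have E : (fun h : R => h^-1 *: (((fun s => g (x + s *: v)) \o shift t) (h *: 1) - g (x + t *: v)))
   = (fun h : R => h^-1 *: ((g \o shift (x + t *: v)) (h *: v) - g (x + t *: v))).
  apply/funext => h /=; congr (_ *: (g _ - _)).
  by rewrite [h *: 1]mulr1 scalerDl addrCA.
by move=> dg; split; rewrite /derivable /derive E.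
Qed.

Lemma partial_increment (R : realType) (d : nat) (g : 'rV[R]_d -> R)
  (x0 x : 'rV[R]_d) (i : 'I_d) (r h M a : R) :
  (forall z, ball x0 r z -> derivable g z (evec R i) /\ `|'D_(evec R i) g z - h| <= M) ->
  ball x0 r x -> ball x0 r (x + a *: evec R i) ->
  `|g (x + a *: evec R i) - g x - h * a| <= M * `|a|.
Proof.
set v := evec R i => dg Bx Bxa.
have r0 : 0 < r by case: Bx.
(* The increment [a] may have either sign, so the mean value theorem runs over the interval between
   [0] and [a]. *)
pose lo := Num.min 0 a; pose hi := Num.max 0 a.
have lohi : lo <= hi by rewrite /lo /hi ge_min le_max lexx.
have conv s : lo <= s <= hi -> ball x0 r (x + s *: v).
  move=> /andP[s0 sa]; apply/ball_rV => // j.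
  move/(ball_rV _ _ r0)/(_ j) : Bx; move/(ball_rV _ _ r0)/(_ j) : Bxa.
  rewrite !mxE eqxx /=; case: (j == i); rewrite ?mulr1 ?mulr0 ?addr0// => h1 h2.
  move: s0 sa; rewrite /lo /hi; case: (leP 0 a) => a0 s0 sa.
    by move: h1 h2; rewrite !ltr_norml => /andP[? ?] /andP[? ?]; apply/andP; split; lra.
  by move: h1 h2; rewrite !ltr_norml => /andP[? ?] /andP[? ?]; apply/andP; split; lra.
pose f s := g (x + s *: v); pose df s := 'D_v g (x + s *: v).
have fd s : lo <= s <= hi -> is_derive s 1 f (df s).
  by move=> /conv /dg[dgs _]; exact: is_derive_line.
have [s||s sI] := @MVT_segment R f df lo hi lohi.
- by rewrite in_itv /= => /andP[/ltW s0 /ltW s1]; apply: fd; rewrite s0.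
- apply: derivable_within_continuous => s; rewrite in_itv /= => sI.
  by case: (fd s sI).
have := dg _ (conv s sI) => -[_]; rewrite -/(df s) => ds fE.
suff -> : g (x + a *: v) - g x - h * a = (df s - h) * a.
  by rewrite normrM ler_wpM2r.
have f0 : f 0 = g x by rewrite /f scale0r addr0.
rewrite -f0 -/(f a); move: fE; rewrite /lo /hi.
case: (leP 0 a) => a0 fE; first by rewrite fE; ring.
by rewrite -(opprB (f 0) (f a)) fE; ring.
Qed.

(* Move from [x'] to [x] one coordinate at a time; sup-norm balls contain the
   whole path, so that only partial derivatives are involved. *)
Lemma box_increment (R : realType) (d : nat) (g : 'rV[R]_d -> R)
  (x0 x x' : 'rV[R]_d) (r M : R) (h : 'I_d -> R) :
  (forall i z, ball x0 r z -> derivable g z (evec R i) /\ `|'D_(evec R i) g z - h i| <= M) ->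
  ball x0 r x -> ball x0 r x' ->
  `|g x - g x' - \sum_i h i * (x ord0 i - x' ord0 i)| <= d%:R * M * `|x - x'|.
Proof.
move=> dg Bx Bx'; have r0 : 0 < r by case: Bx.
pose z (k : nat) : 'rV[R]_d := \row_j (if (j < k)%N then x ord0 j else x' ord0 j).
have Bz k : ball x0 r (z k).
  apply/ball_rV => // j; rewrite mxE.
  by case: ifP => _; move: j; apply/ball_rV.
have zS (i : 'I_d) : z i.+1 = z i + (x ord0 i - x' ord0 i) *: evec R i.
  apply/rowP => j; rewrite !mxE eqxx /= ltnS leq_eqVlt.
  have [ji|ji] := eqVneq j i; first by rewrite ji eqxx ltnn /= mulr1 addrC subrK.
  by rewrite val_eqE (negPf ji) /= mulr0 addr0.
have z0 : z 0%N = x' by apply/rowP => j; rewrite mxE.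
have zd : z d = x by apply/rowP => j; rewrite mxE ltn_ord.
have -> : g x - g x' = \sum_(i < d) (g (z i.+1) - g (z i)).
  by rewrite -(big_mkord xpredT (fun i => g (z i.+1) - g (z i))) telescope_sumr// zd z0.
rewrite -sumrB; apply: (le_trans (ler_norm_sum _ _ _)).
apply: (@le_trans _ _ (\sum_(i < d) M * `|x - x'|)); last first.
  by rewrite sumr_const card_ord -mulrA mulr_natl.
apply: ler_sum => i _; rewrite zS.
apply: le_trans (partial_increment (dg i) (Bz i) _) _; first by rewrite -zS.
apply: ler_wpM2l; last first.
  by have := coord_le_norm (x - x') i; rewrite !mxE.
by apply: le_trans (dg i _ Bx).2.
Qed.

Definition cross (T U : Type) (R : realType) (c : T -> U -> R) x y x' y' : R :=
  c x y + c x' y' - c x y' - c x' y.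

Lemma nbhs_prod_ball (R : realType) (d : nat) (x0 y0 : 'rV[R]_d) (A : set ('rV[R]_d * 'rV[R]_d)) :
  nbhs (x0, y0) A ->
  exists2 r, 0 < r & forall x y, ball x0 r x -> ball y0 r y -> A (x, y).
Proof.
move=> /nbhs_ballP[r r0 h]; exists r => // x y Bx By.
by apply: h; split.
Qed.

(** Two applications of [box_increment]: the cross difference is the increment in the second
    variable of [c x - c x'], whose partials are increments in the first variable of [Dy j c], and
    the partials of these are close to the mixed Hessian at the centre. *)
Lemma cross_approx (R : realType) (d : nat) (Om Op : set 'rV[R]_d)
  (c : 'rV[R]_d -> 'rV[R]_d -> R) (x0 y0 : 'rV[R]_d) (e : R) :
  open Om -> open Op -> C2_on Om Op c -> Om x0 -> Op y0 -> 0 < e ->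
  exists2 r, 0 < r & forall x y x' y',
    ball x0 r x -> ball y0 r y -> ball x0 r x' -> ball y0 r y' ->
    `|cross c x y x' y' - \sum_i \sum_j (x - x') ord0 i *
        (mixed_hessian c x0 y0 i j * (y - y') ord0 j)| <= e * (`|x - x'| * `|y - y'|).
Proof.
move=> oOm oOp [[cc c1 cx cy] c2] Omx0 Opy0 e0.
(* Each of the two increments costs a factor [d]; the added one keeps the denominator positive when
   [d = 0]. *)
pose e' := e / (d%:R * d%:R + 1).
have d0 : 0 < d%:R * d%:R + 1 :> R by rewrite ltr_wpDl// mulr_ge0.
have e'0 : 0 < e' by exact: divr_gt0.
have oprod : nbhs (x0, y0) (Om `*` Op).
  by exists (Om, Op) => //; split; exact: open_nbhs_nbhs.
have hij (ij : 'I_d * 'I_d) : \forall z \near (x0, y0),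
    `|Dx ij.1 (Dy ij.2 c) z.1 z.2 - mixed_hessian c x0 y0 ij.1 ij.2| <= e'.
  case: ij => i j /=; have [_ [_ _ + _]] := c2 j => /(_ i x0 y0 Omx0 Opy0) h.
  move/cvgrPdist_le : h => /(_ _ e'0); apply: filterS => z.
  by rewrite mxE distrC.
have Hn : nbhs (x0, y0) ((Om `*` Op) `&` [set z | forall ij : 'I_d * 'I_d,
    `|Dx ij.1 (Dy ij.2 c) z.1 z.2 - mixed_hessian c x0 y0 ij.1 ij.2| <= e']).
  by apply: filterI => //; apply: filterS (filter_forall _ hij).
have [r r0 {}Hn] := nbhs_prod_ball Hn.
exists r => // x y x' y' Bx By Bx' By'.
pose F z := c x z - c x' z; pose H := mixed_hessian c x0 y0.
have step j z : ball y0 r z -> derivable F z (evec R j) /\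
   `|'D_(evec R j) F z - \sum_i H i j * (x ord0 i - x' ord0 i)| <= d%:R * e' * `|x - x'|.
  move=> Bz; have [[Omx Opz] _] := Hn _ _ Bx Bz; have [[Omx' _] _] := Hn _ _ Bx' Bz.
  have dx := (c1 j _ _ Omx Opz).2; have dx' := (c1 j _ _ Omx' Opz).2.
  split; first exact: derivableB.
  rewrite deriveB //.
  apply: (box_increment (g := fun x => Dy j c x z) (x0 := x0) (r := r)) => // i w Bw.
  have [[Omw _] hw] := Hn _ _ Bw Bz; split; last exact: (hw (i, j)).
  by have [_ [_ h _ _]] := c2 j; exact: (h i w z Omw Opz).1.
have := box_increment step By By'.
have -> : F y - F y' = cross c x y x' y' by rewrite /F /cross; ring.
have -> : \sum_j (\sum_i H i j * (x ord0 i - x' ord0 i)) * (y ord0 j - y' ord0 j) =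
   \sum_i \sum_j (x - x') ord0 i * (H i j * (y - y') ord0 j).
  rewrite exchange_big /=; apply: eq_bigr => j _; rewrite mulr_suml; apply: eq_bigr => i _.
  by rewrite !mxE; ring.
move/le_trans; apply.
rewrite (_ : _ * _ = (d%:R * d%:R * e') * (`|x - x'| * `|y - y'|)); last by ring.
apply: ler_wpM2r; first exact: mulr_ge0.
by rewrite /e' mulrCA ger_pMr// ler_pdivrMr// mul1r lerDl.
Qed.

(** The constant is the sum of the absolute entries of the inverse; one is added so that it is
    positive even in dimension zero. *)
Lemma unitmx_lower_bound (R : realType) (d : nat) (H : 'M[R]_d) : H \in unitmx ->
  exists2 k, 0 < k & forall p q : 'rV[R]_d, (forall i, q ord0 i = \sum_j H i j * p ord0 j) ->
    `|p| <= k * `|q|.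
Proof.
move=> Hu; pose k : R := \sum_i \sum_j `|invmx H i j|.
have k0 : 0 <= k by apply: sumr_ge0 => i _; apply: sumr_ge0.
exists (k + 1); first by rewrite ltr_wpDl.
move=> p q pq; apply: (@le_trans _ _ (k * `|q|)); last by rewrite ler_wpM2r// lerDl.
have pE : p^T = invmx H *m q^T.
  have -> : q^T = H *m p^T.
    by apply/colP => i; rewrite !mxE pq; apply: eq_bigr => j _; rewrite mxE.
  by rewrite mulKmx.
apply/rV_normP; first exact: mulr_ge0.
move=> i; have -> : p ord0 i = p^T i ord0 by rewrite mxE.
rewrite pE mxE; apply: le_trans (ler_norm_sum _ _ _) _.
apply: (@le_trans _ _ (\sum_j `|invmx H i j| * `|q|)).
  by apply: ler_sum => j _; rewrite normrM mxE ler_wpM2l// coord_le_norm.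
rewrite -mulr_suml ler_wpM2r// /k [leRHS](bigD1 i)//= lerDl.
by apply: sumr_ge0 => i' _; apply: sumr_ge0.
Qed.

(* Minty's trick: with [u = p + q] and [v = p - q] one has
   [4 p.q = |u|^2 - |v|^2], so an upper bound on the cross difference
   makes [u] a Lipschitz function of [v] up to an error of order [del]. *)
Lemma minty_local (R : realType) (d : nat) (p q : 'rV[R]_d) (D del e : R) :
  0 < del -> `|D - \sum_i p ord0 i * q ord0 i| <= e * (`|p| * `|q|) ->
  0 <= e <= 4^-1 -> D <= 2 * del ^+ 2 -> (forall i, `|p ord0 i - q ord0 i| <= del) ->
  `|p| <= (17 + 4 * d%:R) * del /\ `|q| <= (17 + 4 * d%:R) * del.
Proof.
move=> del0 Dpq /andP[e0 e4] Ddel pq.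
pose u i := p ord0 i + q ord0 i; pose v i := p ord0 i - q ord0 i.
pose U := \sum_i u i ^+ 2; pose V := \sum_i v i ^+ 2.
have sqn (x : 'rV[R]_d) : `|x| ^+ 2 <= \sum_i x ord0 i ^+ 2.
  have h : `|x| <= Num.sqrt (\sum_i x ord0 i ^+ 2).
    apply/rV_normP; first exact: sqrtr_ge0.
    move=> i; rewrite -sqrtr_sqr ler_wsqrtr// (bigD1 i)//= lerDl.
    by apply: sumr_ge0 => *; exact: sqr_ge0.
  rewrite -(@sqr_sqrtr _ (\sum_i x ord0 i ^+ 2)); last by apply: sumr_ge0 => *; exact: sqr_ge0.
  by rewrite lerXn2r// ?nnegrE ?sqrtr_ge0.
have pqE : \sum_i p ord0 i * q ord0 i = 4^-1 * (U - V).
  by rewrite /U /V -sumrB mulr_sumr; apply: eq_bigr => i _; rewrite /u /v; field.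
have pqn : `|p| * `|q| <= 4^-1 * (U + V).
  have -> : 4^-1 * (U + V) = 2^-1 * (\sum_i p ord0 i ^+ 2 + \sum_i q ord0 i ^+ 2).
    by rewrite /U /V -!big_split /= !mulr_sumr; apply: eq_bigr => i _; rewrite /u /v; field.
  have := sqn p; have := sqn q; have : 0 <= (`|p| - `|q|) ^+ 2 by exact: sqr_ge0.
  by rewrite sqrrB => h1 h2 h3; lra.
have V0 : V <= d%:R * del ^+ 2.
  rewrite mulr_natl -[d in _ *+ d]card_ord -sumr_const; apply: ler_sum => i _.
  rewrite -real_normK ?num_real//; apply: lerXn2r; rewrite ?nnegrE ?(ltW del0)//.
  exact: pq.
have U0 : 0 <= U by apply: sumr_ge0 => *; exact: sqr_ge0.
have Vp : 0 <= V by apply: sumr_ge0 => *; exact: sqr_ge0.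
(* The error is at most [(U + V) / 16], so [(U - V) / 4 <= 2 del^2 + (U + V) / 16], that is
   [3 U <= 32 del^2 + 5 V]; the constants are then rounded up. *)
have Ub : U <= (16 + 3 * d%:R) * del ^+ 2.
  have e1 : e * (`|p| * `|q|) <= 4^-1 * (4^-1 * (U + V)).
    by apply: ler_pM e0 _ e4 pqn; rewrite mulr_ge0 ?normr_ge0.
  have del2 : 0 <= del ^+ 2 by exact: sqr_ge0.
  have ddel2 : 0 <= d%:R * del ^+ 2 by exact: mulr_ge0.
  move: Dpq; rewrite pqE ler_norml => /andP[h _]; lra.
have d0 : 0 <= d%:R :> R by [].
have ub i : `|u i| <= (16 + 3 * d%:R) * del.
  have h : u i ^+ 2 <= ((16 + 3 * d%:R) * del) ^+ 2.
    apply: (@le_trans _ _ U).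
      by rewrite /U (bigD1 i)//= lerDl; apply: sumr_ge0 => *; exact: sqr_ge0.
    apply: le_trans Ub _; rewrite exprMn ler_wpM2r ?sqr_ge0//.
    by rewrite expr2 ler_peMl//; lra.
  rewrite -(@ler_pXn2r _ 2)// ?nnegrE//; last by apply: mulr_ge0; [lra|exact: ltW].
  by rewrite real_normK ?num_real.
have K0 : 0 <= (17 + 4 * d%:R) * del by apply: mulr_ge0; [lra|exact: ltW].
have dd : 0 <= d%:R * del by rewrite mulr_ge0// ltW.
by split; apply/rV_normP => // i; have := ub i; have := pq i; rewrite /u !ler_norml;
  move=> /andP[h1 h2] /andP[h3 h4]; apply/andP; split; lra.
Qed.

(** Pairs have [2 d] coordinates but only [O(del^-d)] labels are allowed: the bound on the cross
    difference has to control the remaining [d] directions. Since [C] and [K] are fixed before [del]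
    and the property is stable under unions, it can be checked near each point. *)
Definition coverable (R : realType) (d : nat) (c : 'rV[R]_d -> 'rV[R]_d -> R)
  (S : set ('rV[R]_d * 'rV[R]_d)) :=
  exists C K : R, [/\ 0 <= C, 0 <= K & forall del, 0 < del <= 1 ->
    exists (T : finType) (k : 'rV[R]_d * 'rV[R]_d -> T),
      #|T|%:R <= C / del ^+ d /\
      forall x y x' y', S (x, y) -> S (x', y') -> k (x, y) = k (x', y') ->
        cross c x y x' y' <= 2 * del ^+ 2 ->
        [/\ `|x - x'| <= K * del, `|y - y'| <= K * del &
            `|cross c x y x' y'| <= K * del ^+ 2]].

Lemma coverable0 (R : realType) (d : nat) (c : 'rV[R]_d -> 'rV[R]_d -> R) :
  coverable c set0.
Proof.
exists 1, 0; split => // del /andP[del0 del1]; exists unit, (fun=> tt); split => //.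
by rewrite card_unit mul1r invf_ge1 ?exprn_gt0// exprn_ile1// ltW.
Qed.

Lemma coverableS (R : realType) (d : nat) (c : 'rV[R]_d -> 'rV[R]_d -> R)
  (A B : set ('rV[R]_d * 'rV[R]_d)) :
  A `<=` B -> coverable c B -> coverable c A.
Proof.
move=> AB [C [K [C0 K0 h]]]; exists C, K; split => // del /h[T [k [cT hk]]].
by exists T, k; split => // x y x' y' Sz Sz'; apply: hk; exact: AB.
Qed.

(** Pairs in [A] keep the labels of [A] and the others take those of [B], so a common label places
    both pairs in the same set. *)
Lemma coverableU (R : realType) (d : nat) (c : 'rV[R]_d -> 'rV[R]_d -> R)
  (A B : set ('rV[R]_d * 'rV[R]_d)) :
  coverable c A -> coverable c B -> coverable c (A `|` B).
Proof.
move=> [C1 [K1 [C10 K10 h1]]] [C2 [K2 [C20 K20 h2]]].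
exists (C1 + C2), (K1 + K2); split; rewrite ?addr_ge0// => del del01.
have [T1 [k1 [cT1 hk1]]] := h1 _ del01; have [T2 [k2 [cT2 hk2]]] := h2 _ del01.
exists (T1 + T2)%type, (fun z => if z \in A then inl (k1 z) else inr (k2 z)); split.
  by rewrite card_sum natrD mulrDl lerD.
have mem_B z : (A `|` B) z -> (z \in A) = false -> B z.
  by move=> [/mem_set ->|].
have [del0 _] := andP del01.
move=> x y x' y' ABz ABz'; case: ifPn => Az; case: ifPn => Az' //= [kk] Dz.
  have [] := hk1 _ _ _ _ (set_mem Az) (set_mem Az') kk Dz => a b e.
  by split; [apply: le_trans a _|apply: le_trans b _|apply: le_trans e _];
    rewrite mulrDl lerDl mulr_ge0 ?sqr_ge0// ltW.
have [] := hk2 _ _ _ _ (mem_B _ ABz (negbTE Az)) (mem_B _ ABz' (negbTE Az')) kk Dz => a b e.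
by split; [apply: le_trans a _|apply: le_trans b _|apply: le_trans e _];
  rewrite mulrDl lerDr mulr_ge0 ?sqr_ge0// ltW.
Qed.

Lemma truncn_eq_dist (R : realType) (x y : R) : 0 <= x -> 0 <= y ->
  Num.truncn x = Num.truncn y -> `|x - y| <= 1.
Proof.
move=> x0 y0 xy; have /andP[h1 h2] := truncn_itv x0; have /andP[h3 h4] := truncn_itv y0.
move: h1 h2; rewrite xy => h1 h2; move: h4 h2; rewrite -natr1 => h4 h2.
by rewrite ler_norml; apply/andP; split; lra.
Qed.

(** The label of a pair records the cell of mesh [del] containing [v = x - H y]. As [v] has [d]
    coordinates in a bounded range, [O(del^-d)] labels suffice, and [minty_local] applies to
    [p = x - x'] and [q = H (y - y')]; invertibility of [H] brings the bound back to [y - y']. *)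
Lemma coverable_local (R : realType) (d : nat) (Om Op : set 'rV[R]_d)
  (c : 'rV[R]_d -> 'rV[R]_d -> R) (x0 y0 : 'rV[R]_d) :
  open Om -> open Op -> C2_on Om Op c -> inf_twisted Om Op c -> Om x0 -> Op y0 ->
  exists2 U, nbhs (x0, y0) U & coverable c U.
Proof.
move=> oOm oOp c2 tw Ox Oy; pose H := mixed_hessian c x0 y0.
have [k k0 Hk] := unitmx_lower_bound (tw _ _ Ox Oy).
(* Since [|y - y'| <= k |H (y - y')|], this accuracy makes the error at most a quarter of
   [|x - x'| |H (y - y')|], as [minty_local] requires. *)
have e0 : 0 < (4 * k)^-1 by rewrite invr_gt0 mulr_gt0.
have [r r0 Hc] := cross_approx oOm oOp c2 Ox Oy e0.
exists (ball x0 r `*` ball y0 r).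
  by exists (ball x0 r, ball y0 r) => //; split; exact: nbhsx_ballx.
pose v i (z : 'rV[R]_d * 'rV[R]_d) := z.1 ord0 i - \sum_j H i j * z.2 ord0 j.
pose B := r * (1 + \sum_i \sum_j `|H i j|).
have S0 : 0 <= \sum_i \sum_j `|H i j| by apply: sumr_ge0 => i _; apply: sumr_ge0.
have B0 : 0 < B by rewrite mulr_gt0// ltr_pwDl.
have vB i z : (ball x0 r `*` ball y0 r) z -> `|v i z - v i (x0, y0)| <= B.
  case: z => x y [/= /(ball_rV _ _ r0) Bx /(ball_rV _ _ r0) By].
  rewrite (_ : v i _ - _ = (x ord0 i - x0 ord0 i) - \sum_j H i j * (y ord0 j - y0 ord0 j)); last first.
    by rewrite /v /=; under [in RHS]eq_bigr do rewrite mulrBr; rewrite sumrB; ring.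
  apply: le_trans (ler_normB _ _) _; rewrite /B mulrDr mulr1 lerD//.
    by rewrite distrC ltW.
  apply: le_trans (ler_norm_sum _ _ _) _.
  apply: (@le_trans _ _ (\sum_j r * `|H i j|)).
    by apply: ler_sum => j _; rewrite normrM mulrC ler_wpM2r// distrC ltW.
  rewrite -mulr_sumr ler_pM2l// [leRHS](bigD1 i)//= lerDl.
  by apply: sumr_ge0 => i' _; apply: sumr_ge0.
pose K0 : R := 17 + 4 * d%:R.
have K00 : 0 <= K0 by rewrite addr_ge0// mulr_ge0.
(* There are at most [(2 B / del + 1)^d] labels, and [del <= 1] absorbs the one. The three summands
   of the second constant serve the bounds on [x - x'], on [y - y'] and on the cross difference. *)
exists ((2 * B + 1) ^+ d), (K0 + k * K0 + (d%:R + 1) * K0 ^+ 2).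
have kK0 : 0 <= k * K0 by apply: mulr_ge0 => //; exact: ltW.
have dK0 : 0 <= (d%:R + 1) * K0 ^+ 2 by rewrite mulr_ge0// ?sqr_ge0// addr_ge0.
have C0 : 0 <= 2 * B + 1 by lra.
split; first exact: exprn_ge0.
  by rewrite !addr_ge0.
move=> del /andP[del0 del1].
pose q := Num.truncn (2 * B / del).
pose w i z := (v i z - v i (x0, y0) + B) / del.
have Bd0 : 0 <= 2 * B / del by apply: divr_ge0; [lra|exact: ltW].
have wI i z : (ball x0 r `*` ball y0 r) z -> 0 <= w i z <= 2 * B / del.
  move=> /(vB i); rewrite ler_norml => /andP[h1 h2].
  rewrite /w ler_pM2r ?invr_gt0// pmulr_lge0 ?invr_gt0//; apply/andP; split; lra.
exists {ffun 'I_d -> 'I_q.+1}, (fun z => [ffun i => inord (Num.truncn (w i z))]); split.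
  rewrite card_ffun !card_ord natrX -expr_div_n; apply: lerXn2r; rewrite ?nnegrE//.
    by apply: divr_ge0 => //; exact: ltW.
  rewrite -natr1 mulrDl lerD//; first by have /andP[] := truncn_itv Bd0.
  by rewrite mul1r invf_ge1.
move=> x y x' y' Bz Bz' kk Dz.
pose p := x - x'; pose qq : 'rV[R]_d := \row_i \sum_j H i j * (y - y') ord0 j.
have yq : `|y - y'| <= k * `|qq| by apply: Hk => i; rewrite mxE.
have pv i : `|p ord0 i - qq ord0 i| <= del.
  have wi : `|w i (x, y) - w i (x', y')| <= 1.
    have /andP[w0 w1] := wI i _ Bz; have /andP[w0' w1'] := wI i _ Bz'.
    apply: truncn_eq_dist => //.
    move/ffunP/(_ i) : kk; rewrite !ffunE => /(congr1 val) /=.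
    by rewrite !inordK// ltnS le_truncn.
  have -> : p ord0 i - qq ord0 i = (w i (x, y) - w i (x', y')) * del.
    have -> : qq ord0 i = \sum_j H i j * y ord0 j - \sum_j H i j * y' ord0 j.
      by rewrite mxE -sumrB; apply: eq_bigr => j _; rewrite !mxE mulrBr.
    by rewrite /w -mulrBl mulfVK ?gt_eqF// /v /= !mxE; ring.
  by rewrite normrM (gtr0_norm del0) ler_piMl// ltW.
have Dpq : `|cross c x y x' y' - \sum_i p ord0 i * qq ord0 i| <= 4^-1 * (`|p| * `|qq|).
  have := Hc _ _ _ _ Bz.1 Bz.2 Bz'.1 Bz'.2.
  rewrite (_ : \sum_i \sum_j _ = \sum_i p ord0 i * qq ord0 i); last first.
    by apply: eq_bigr => i _; rewrite -mulr_sumr; congr (_ * _); rewrite mxE.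
  move/le_trans; apply.
  apply: (@le_trans _ _ ((4 * k)^-1 * (`|p| * (k * `|qq|)))).
    by rewrite ler_pM2l// ler_wpM2l.
  by rewrite le_eqVlt; apply/orP; left; apply/eqP; field; rewrite gt_eqF.
have [|hp hq] := minty_local del0 Dpq _ Dz pv; first by rewrite lexx invr_ge0 ler0n.
have d2 : 0 <= del ^+ 2 by exact: sqr_ge0.
have pq_le : `|p| * `|qq| <= K0 ^+ 2 * del ^+ 2.
  by rewrite -exprMn expr2 ler_pM.
split.
- by apply: le_trans hp _; rewrite ler_pM2r// -/K0 -addrA lerDl addr_ge0.
- apply: le_trans yq _; apply: (@le_trans _ _ (k * (K0 * del))); first by rewrite ler_pM2l.
  by rewrite mulrA ler_pM2r// -/K0 -addrA addrCA lerDl addr_ge0.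
- apply: (@le_trans _ _ ((d%:R + 1) * (`|p| * `|qq|))); last first.
    apply: (@le_trans _ _ ((d%:R + 1) * (K0 ^+ 2 * del ^+ 2))).
      by rewrite ler_wpM2l// addr_ge0.
    by rewrite mulrA ler_wpM2r// lerDr addr_ge0.
  have spq : `|\sum_i p ord0 i * qq ord0 i| <= d%:R * (`|p| * `|qq|).
    apply: le_trans (ler_norm_sum _ _ _) _.
    rewrite mulr_natl -[d in _ *+ d]card_ord -sumr_const; apply: ler_sum => i _.
    by rewrite normrM ler_pM// coord_le_norm.
  rewrite -[X in `|X|](subrK (\sum_i p ord0 i * qq ord0 i)).
  apply: le_trans (ler_normD _ _) _; rewrite addrC mulrDl mul1r lerD//.
  by apply: le_trans Dpq _; rewrite ler_piMl ?mulr_ge0 ?invf_le1 ?ler1n.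
Qed.

Lemma coverable_compact (R : realType) (d : nat) (Om Op Xm Xp : set 'rV[R]_d)
  (c : 'rV[R]_d -> 'rV[R]_d -> R) :
  open Om -> open Op -> C2_on Om Op c -> inf_twisted Om Op c ->
  compact Xm -> Xm `<=` Om -> compact Xp -> Xp `<=` Op ->
  coverable c (Xm `*` Xp).
Proof.
move=> oOm oOp c2 tw cXm XmO cXp XpO.
apply: (compact_induction (compact_setX cXm cXp)).
- exact: coverable0.
- exact: coverableU.
- exact: coverableS.
- move=> [x0 y0] [/= Xx Xy]; apply: coverable_local c2 tw _ _ => //; [exact: XmO|exact: XpO].
Qed.

(** * Gluing finite couplings, and sums over level sets *)

Lemma fin_coupling_le (R : realType) (I J : finType) (a : I -> R) (b : J -> R)
  (g : I -> J -> R) i j : fin_coupling a b g -> g i j <= a i /\ g i j <= b j.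
Proof.
move=> [g0 ga gb]; rewrite -(ga i) -(gb j).
by split; [rewrite [leRHS](bigD1 j)|rewrite [leRHS](bigD1 i)];
  rewrite //= lerDl; apply: sumr_ge0.
Qed.

Lemma fin_coupling_sum (R : realType) (I J : finType) (a : I -> R) (b : J -> R)
  (g : I -> J -> R) (phi : I -> R) (psi : J -> R) : fin_coupling a b g ->
  \sum_i \sum_j g i j * (phi i + psi j) = \sum_i a i * phi i + \sum_j b j * psi j.
Proof.
move=> [g0 ga gb]; under eq_bigr do under eq_bigr do rewrite mulrDr.
under eq_bigr do rewrite big_split /=.
rewrite big_split /=; congr (_ + _).
  by apply: eq_bigr => i _; rewrite -mulr_suml ga.
by rewrite exchange_big; apply: eq_bigr => j _; rewrite -mulr_suml gb.
Qed.

Section gluing.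
Context (R : realType) (I J T : finType) (a : I -> R) (b : J -> R).
Variables (g : I -> J -> R) (k : I -> J -> T).
Hypothesis gab : fin_coupling a b g.
Hypothesis a1 : \sum_i a i = 1.

Let A t i := \sum_(j | k i j == t) g i j.
Let B t j := \sum_(i | k i j == t) g i j.
Let m t := \sum_i A t i.

(** On each label the plan is replaced by the normalised product of the marginals of its restriction
    to that label, which has mass [m t]. *)
Definition glued i j := \sum_t A t i * B t j / m t.

Let g0 i j : 0 <= g i j. Proof. by case: gab. Qed.
Let A0 t i : 0 <= A t i. Proof. exact: sumr_ge0. Qed.
Let B0 t j : 0 <= B t j. Proof. exact: sumr_ge0. Qed.
Let m0 t : 0 <= m t. Proof. exact: sumr_ge0. Qed.

Let mB t : m t = \sum_j B t j.
Proof. by rewrite /m /A /B (exchange_big_dep xpredT). Qed.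

Let sumA i : \sum_t A t i = a i.
Proof.
case: gab => _ <- _; rewrite /A (exchange_big_dep xpredT)//=.
by apply: eq_bigr => j _; rewrite (big_pred1 (k i j))// => t; rewrite eq_sym.
Qed.

Let sumB j : \sum_t B t j = b j.
Proof.
case: gab => _ _ <-; rewrite /B (exchange_big_dep xpredT)//=.
by apply: eq_bigr => i _; rewrite (big_pred1 (k i j))// => t; rewrite eq_sym.
Qed.

Let summ : \sum_t m t = 1.
Proof. by rewrite /m exchange_big /= -a1; apply: eq_bigr => i _; exact: sumA. Qed.

Let Am t i : A t i <= m t.
Proof. by rewrite /m (bigD1 i)//= lerDl sumr_ge0. Qed.

Let Bm t j : B t j <= m t.
Proof. by rewrite mB (bigD1 j)//= lerDl sumr_ge0. Qed.

Let Aa t i : A t i <= a i.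
Proof. by rewrite -sumA [leRHS](bigD1 t)//= lerDl sumr_ge0. Qed.

Let Bb t j : B t j <= b j.
Proof. by rewrite -sumB [leRHS](bigD1 t)//= lerDl sumr_ge0. Qed.

Let p0 t i j : 0 <= A t i * B t j / m t.
Proof. by rewrite divr_ge0 ?mulr_ge0. Qed.

Lemma glued_coupling : fin_coupling a b glued.
Proof.
(* For [m t = 0] the division yields zero, which is right because [x] lies between zero and
   [m t]. *)
have mK (x : R) t : 0 <= x <= m t -> x * m t / m t = x.
  have [->|mt _] := eqVneq (m t) 0; last by rewrite mulfK.
  by move=> ?; rewrite mulr0 mul0r; apply/esym/eqP; rewrite eq_le andbC.
split => [i j|i|j]; first exact: sumr_ge0.
  rewrite exchange_big /= -sumA; apply: eq_bigr => t _.
  by rewrite -mulr_suml -mulr_sumr -mB mK ?A0 ?Am.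
rewrite exchange_big /= -sumB; apply: eq_bigr => t _.
by rewrite -mulr_suml -mulr_suml -/(m t) [m t * _]mulrC mK ?B0 ?Bm.
Qed.

(** The glued plan charges a pair only if its two indices each occur in pairs charged by [g] with
    one common label, so the slack needs a bound only at swapped pairs; the potentials integrate to
    the same value because the marginals are kept. *)
Lemma glued_cost (c : I -> J -> R) (s : R) (phi : I -> R) (psi : J -> R) :
  (forall i j i' j', 0 < g i j -> 0 < g i' j' -> k i j = k i' j' ->
     c i j' - phi i - psi j' <= s) ->
  \sum_i \sum_j glued i j * c i j <= \sum_i a i * phi i + \sum_j b j * psi j + s.
Proof.
move=> Es; rewrite -(fin_coupling_sum phi psi glued_coupling).
have -> : s = \sum_i \sum_j glued i j * s.
  case: glued_coupling => _ ga _.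
  under eq_bigr do rewrite -mulr_suml ga.
  by rewrite -mulr_suml a1 mul1r.
rewrite -big_split /=; apply: ler_sum => i _; rewrite -big_split /=; apply: ler_sum => j _.
rewrite -mulrDr /glued !mulr_suml; apply: ler_sum => t _.
have [->|pt] := eqVneq (A t i * B t j / m t) 0; first by rewrite !mul0r.
apply: ler_wpM2l => //.
have pos (X : finType) (P : pred X) (F : X -> R) : (forall x, 0 <= F x) ->
    \sum_(x | P x) F x != 0 -> exists2 x, P x & 0 < F x.
  move=> F0; apply: contra_neqP => H; apply: big1 => x Px.
  apply/eqP; rewrite eq_le F0 andbT leNgt; apply/negP => Fx; apply: H; by exists x.
have [Ati Btj] : A t i != 0 /\ B t j != 0.
  by move: pt; rewrite !mulf_eq0 !negb_or => /andP[/andP[]].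
have [j' /eqP kj' gj'] := pos _ _ _ (g0 i) Ati.
have [i' /eqP ki' gi'] := pos _ _ _ (g0^~ j) Btj.
by have := Es i j' i' j gj' gi'; rewrite kj' ki' => /(_ erefl); lra.
Qed.

(* The entropy is the mutual information of a Markov chain through the label
   in [T], hence at most [ln #|T|]; here this is obtained termwise from
   [ln x <= x - 1]. *)
Lemma glued_entropy :
  \sum_i \sum_j glued i j * ln (glued i j / (a i * b j)) <= ln #|T|%:R.
Proof.
have [gg0 ga gb] := glued_coupling; set N : R := #|T|%:R.
have N0 : 0 < N.
  rewrite ltr0n; apply/card_gt0P; have [t _|T0] := pickP T; first by exists t.
  by move/eqP: summ; rewrite big_pred0// eq_sym oner_eq0.
(* With [p] the weight of label [t] and [X] the first term on the right, this is
   [p ln (X / p) <= X - p], after enlarging the argument of the logarithm by replacing [b j] with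
   the smaller [B t j]. *)
have step t i j : A t i * B t j / m t * ln (glued i j / (a i * b j) / N) <=
    glued i j * (A t i / m t) / (a i * N) - A t i * B t j / m t.
  set p := A t i * B t j / m t; have [pE|pt] := eqVneq p 0.
    have ai : 0 <= a i by rewrite -ga sumr_ge0.
    rewrite pE mul0r subr0; apply: mulr_ge0; last by rewrite invr_ge0 mulr_ge0// ltW.
    by rewrite mulr_ge0 ?gg0// divr_ge0.
  have pp : 0 < p by rewrite lt_def pt p0.
  move: pt; rewrite /p !mulf_eq0 !negb_or => /andP[/andP[At Bt]]; rewrite invr_eq0 => mt.
  have At0 : 0 < A t i by rewrite lt_def At A0.
  have Bt0 : 0 < B t j by rewrite lt_def Bt B0.
  have mt0 : 0 < m t by rewrite lt_def mt m0.
  have ai : 0 < a i by exact: lt_le_trans (Aa t i).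
  have bj : 0 < b j by exact: lt_le_trans (Bb t j).
  have gp : 0 < glued i j.
    by apply: (lt_le_trans pp); rewrite /glued (bigD1 t)//= lerDl sumr_ge0.
  pose X := glued i j * (A t i / m t) / (a i * N).
  have X0 : 0 < X by rewrite divr_gt0 ?mulr_gt0 ?invr_gt0.
  have XE : X / p = glued i j / (a i * B t j) / N.
    by rewrite /X /p; field; rewrite !gt_eqF.
  have lnle : ln (glued i j / (a i * b j) / N) <= X / p - 1.
    apply: (@le_trans _ _ (ln (X / p))).
      rewrite XE ler_ln ?posrE; [|by rewrite !divr_gt0 ?mulr_gt0|by rewrite !divr_gt0 ?mulr_gt0].
      rewrite ler_pM2r ?invr_gt0// ler_pM2l// lef_pV2 ?posrE ?mulr_gt0//.
      by rewrite ler_pM2l.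
    rewrite -ler_expR lnK; last by rewrite posrE; apply: divr_gt0.
    by have := expR_ge1Dx (X / p - 1); rewrite addrC subrK.
  apply: (@le_trans _ _ (p * (X / p - 1))); first by rewrite ler_pM2l.
  by rewrite mulrBr mulr1 mulrC divfK// gt_eqF.
have lhs : \sum_i \sum_j \sum_t A t i * B t j / m t * ln (glued i j / (a i * b j) / N) =
    \sum_i \sum_j glued i j * ln (glued i j / (a i * b j)) - ln N.
  have -> : ln N = \sum_i \sum_j glued i j * ln N.
    under eq_bigr do rewrite -mulr_suml ga.
    by rewrite -mulr_suml a1 mul1r.
  rewrite -sumrB; apply: eq_bigr => i _; rewrite -sumrB; apply: eq_bigr => j _.
  rewrite -mulr_suml -/(glued i j) -mulrBr.
  have [->|gn] := eqVneq (glued i j) 0; first by rewrite !mul0r.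
  have gp : 0 < glued i j by rewrite lt_def gn gg0.
  have [h1 h2] := fin_coupling_le i j glued_coupling.
  by rewrite [in LHS]ln_div ?posrE ?divr_gt0 ?mulr_gt0//; exact: lt_le_trans gp _.
(* The first terms sum to at most one: the sum over [j] cancels [a i], that over [i] gives at most
   [1 / N], and there are [N] labels. The second terms sum to the total mass, one. *)
have rhs : \sum_i \sum_j \sum_t (glued i j * (A t i / m t) / (a i * N) - A t i * B t j / m t) <= 0.
  have s1 : \sum_i \sum_j \sum_t A t i * B t j / m t = 1.
    by rewrite -a1; apply: eq_bigr => i _; rewrite -ga.
  under eq_bigr do under eq_bigr do rewrite sumrB.
  under eq_bigr do rewrite sumrB.
  rewrite sumrB s1 subr_le0.
  have rowle i t : \sum_j glued i j * (A t i / m t) / (a i * N) <= A t i / m t / N.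
    rewrite -mulr_suml -mulr_suml ga.
    have [->|an] := eqVneq (a i) 0.
      by rewrite !mul0r; apply: divr_ge0; [exact: divr_ge0|exact: ltW].
    by move: (A t i / m t) => x; rewrite le_eqVlt; apply/orP; left; apply/eqP; field; rewrite an gt_eqF.
  apply: (@le_trans _ _ (\sum_i \sum_t A t i / m t / N)).
    apply: ler_sum => i _; rewrite exchange_big /=; apply: ler_sum => t _; exact: rowle.
  rewrite exchange_big /=.
  apply: (@le_trans _ _ (\sum_(t : T) N^-1)); last first.
    by rewrite sumr_const -/N -[N^-1 *+ _]mulr_natl divff// gt_eqF.
  apply: ler_sum => t _; rewrite -mulr_suml -mulr_suml -/(m t).
  rewrite ger_pMl ?invr_gt0//.
  by have [->|mt] := eqVneq (m t) 0; rewrite ?mul0r// divff.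
rewrite -subr_le0 -lhs; apply: le_trans rhs.
by do 3 (apply: ler_sum => ? _).
Qed.
End gluing.

(** The inequality [y <= e^y] at [y = x / n], raised to the power [n]. *)
Lemma exprn_le_expR (R : realType) (x : R) (n : nat) : 0 <= x -> (0 < n)%N ->
  x ^+ n <= n%:R ^+ n * expR x.
Proof.
move=> x0 n0; have np : 0 < n%:R :> R by rewrite ltr0n.
have -> : expR x = expR (x / n%:R) ^+ n.
  by rewrite -expRM_natl mulrC divfK// gt_eqF.
rewrite -exprMn lerXn2r ?nnegrE ?mulr_ge0 ?expR_ge0 ?ler0n//.
rewrite mulrC -ler_pdivrMr//; apply: le_trans (expR_ge1Dx _).
by rewrite lerDr.
Qed.

Lemma sum_inv_sq_le2 (R : realType) (N : nat) : \sum_(n < N) (n.+1%:R ^+ 2)^-1 <= 2 :> R.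
Proof.
(* The induction carries a sharper bound, whose correction term telescopes. *)
suff : \sum_(n < N.+1) (n.+1%:R ^+ 2)^-1 <= 2 - N.+1%:R^-1 :> R.
  rewrite big_ord_recr /= => h.
  by apply: le_trans (le_trans _ h) _; rewrite ?lerDl ?gerBl invr_ge0// exprn_ge0.
elim: N => [|N ih]; first by rewrite big_ord1 expr1n invr1; lra.
rewrite big_ord_recr /=; set x : R := N.+1%:R in ih *.
have x0 : 0 < x by rewrite ltr0n.
have -> : N.+2%:R = x + 1 :> R by rewrite -natr1.
have : ((x + 1) ^+ 2)^-1 <= x^-1 - (x + 1)^-1.
  have -> : x^-1 - (x + 1)^-1 = (x * (x + 1))^-1.
    by field; rewrite !gt_eqF// addr_gt0.
  rewrite lef_pV2 ?posrE ?exprn_gt0 ?mulr_gt0 ?addr_gt0//.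
  by rewrite expr2 ler_pM2r ?addr_gt0// lerDl.
by move=> h; apply: le_trans (lerD ih h) _; rewrite addrA subrK.
Qed.

(* From [n^(d+2) <= (d+2)^(d+2) e^n], which makes [n^d e^(1-n)] summable by
   comparison with [1/n^2], whose sum is at most [2]. *)
Definition cake_const (R : realType) (d : nat) : R :=
  2 * ((d + 2)%:R ^+ (d + 2) * expR 1).

Lemma layer_cake (R : realType) (T : finType) (m E : T -> R) (eps C : R) (d : nat) :
  (forall t, 0 <= m t) -> (forall t, 0 <= E t) -> 0 < eps -> 0 <= C ->
  (forall n, \sum_(t | E t <= n.+1%:R * eps) m t <= C * n.+1%:R ^+ d) ->
  \sum_t m t * expR (- E t / eps) <= cake_const R d * C.
Proof.
move=> m0 E0 eps0 C0 lev; pose l t := Num.truncn (E t / eps).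
pose N := (\max_t l t).+1.
have Ee t : 0 <= E t / eps by rewrite divr_ge0// ltW.
(* Keep only the term [n = l t] of the sum: there the indicator is one, and [l t <= E t / eps]. *)
have pt t : expR (- E t / eps) <=
    \sum_(n < N) (E t <= n.+1%:R * eps)%R%:R * expR (- n%:R).
  have ltN : (l t < N)%N by rewrite ltnS; exact: leq_bigmax.
  have /andP[h1 h2] := truncn_itv (Ee t).
  rewrite (bigD1 (Ordinal ltN))//= -ler_pdivrMr// (ltW h2) /= mul1r.
  apply: (@le_trans _ _ (expR (- (l t)%:R))).
    by rewrite ler_expR mulNr lerN2.
  by rewrite lerDl; apply: sumr_ge0 => i _; rewrite mulr_ge0// expR_ge0.
apply: (@le_trans _ _ (\sum_t m t * \sum_(n < N) (E t <= n.+1%:R * eps)%R%:R * expR (- n%:R))).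
  by apply: ler_sum => t _; exact: ler_wpM2l.
have -> : \sum_t m t * \sum_(n < N) (E t <= n.+1%:R * eps)%R%:R * expR (- n%:R) =
    \sum_(n < N) expR (- n%:R) * \sum_(t | E t <= n.+1%:R * eps) m t.
  under eq_bigr do rewrite mulr_sumr.
  rewrite exchange_big /=; apply: eq_bigr => n _; rewrite mulr_sumr [RHS]big_mkcond /=.
  by apply: eq_bigr => t _; case: ifP => _; rewrite ?mul0r ?mulr0// mul1r mulrC.
apply: (@le_trans _ _ (\sum_(n < N) C * ((d + 2)%:R ^+ (d + 2) * expR 1) * (n.+1%:R ^+ 2)^-1)).
  apply: ler_sum => n _.
  apply: (@le_trans _ _ (expR (- n%:R) * (C * n.+1%:R ^+ d))).
    by apply: ler_wpM2l; [exact: expR_ge0|exact: lev].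
  rewrite mulrCA -mulrA; apply: ler_wpM2l => //.
  rewrite ler_pdivlMr ?exprn_gt0// -mulrA -exprD expRN mulrC ler_pdivrMr ?expR_gt0//.
  rewrite -mulrA -expRD; apply: le_trans (exprn_le_expR _ _) _ => //; first by rewrite addn2.
  by rewrite -natr1 addrC.
rewrite -mulr_sumr /cake_const; apply: (le_trans (ler_wpM2l _ (sum_inv_sq_le2 R N))).
  by rewrite !mulr_ge0// ?expR_ge0// exprn_ge0.
by rewrite le_eqVlt; apply/orP; left; apply/eqP; ring.
Qed.

(** * Boxes, supports and Borel sets *)

(** The integral of a nonnegative function is a supremum over the simple functions below it, so no
    measurability is asked for; this allows comparing the iterated integrals of [leb_int] without
    proving their inner integrals measurable. *)
Lemma ge0_integral_homo d (T : measurableType d) (R : realType)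
  (mu : {measure set T -> \bar R}) (f g : T -> \bar R) :
  (forall x, (0 <= f x)%E) -> (forall x, (f x <= g x)%E) ->
  (\int[mu]_x f x <= \int[mu]_x g x)%E.
Proof.
move=> f0 fg; have g0 x : (0 <= g x)%E by exact: le_trans (fg x).
rewrite !ge0_integralTE//; apply: ereal_sup_le => _ [h hf <-]; exists h => // x.
exact: le_trans (fg x).
Qed.

Lemma leb_int_ge0 (R : realType) (n : nat) (F : 'rV[R]_n -> \bar R) :
  (forall t, (0 <= F t)%E) -> (0 <= leb_int F)%E.
Proof.
elim: n F => [F F0|n ih F F0] /=; first exact: F0.
by apply: integral_ge0 => a _; exact: ih.
Qed.

(** One coordinate is integrated at a time, each contributing the length [2 r] of an interval. *)
Lemma leb_int_box (R : realType) (n : nat) (F : 'rV[R]_n -> \bar R)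
  (x : 'rV[R]_n) (r K : R) : 0 < r -> 0 <= K ->
  (forall t, (0 <= F t <= K%:E)%E) ->
  (forall (t : 'rV[R]_n) j, r <= `|x ord0 j - t ord0 j| -> F t = 0%E) ->
  (leb_int F <= (K * (2 * r) ^+ n)%:E)%E.
Proof.
move=> r0; elim: n F x K => [|n ih] F x K K0 FK Fsupp.
  by rewrite expr0 mulr1 /=; case/andP: (FK 0).
pose x' : 'rV[R]_n := \row_j x ord0 (lift ord0 j).
have vc0 a (t : 'rV[R]_n) : vcons a t ord0 ord0 = a by rewrite mxE unlift_none.
have vcS a (t : 'rV[R]_n) j : vcons a t ord0 (lift ord0 j) = t ord0 j by rewrite mxE liftK.
pose L := K * (2 * r) ^+ n.
have L0 : 0 <= L by rewrite mulr_ge0// exprn_ge0// mulr_ge0// ltW.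
apply: (@le_trans _ _ (\int[@lebesgue_measure R]_a (L * \1_(ball (x ord0 ord0) r) a)%:E)%E).
  rewrite /=; apply: ge0_integral_homo => a.
    by apply: leb_int_ge0 => t; case/andP: (FK (vcons a t)).
  have [aB|aB] := pselect (ball (x ord0 ord0) r (a : R)).
    rewrite indicE mem_set//= mulr1; apply: (ih _ x') => // t j h.
    by apply: (Fsupp _ (lift ord0 j)); rewrite vcS; move: h; rewrite mxE.
  (* Off the interval the first coordinate already makes [F] vanish, so the induction hypothesis
     applies with bound zero. *)
  rewrite indicE memNset//= mulr0 -(mul0r ((2 * r) ^+ n)); apply: (ih _ x') => // t.
    rewrite (Fsupp _ ord0) ?lexx// vc0 leNgt; apply/negP => h.
    exact: aB.
  by move=> j h; apply: (Fsupp _ (lift ord0 j)); rewrite vcS; move: h; rewrite mxE.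
under eq_integral do rewrite EFinM.
rewrite ge0_integralZl//; last first.
  by apply/measurable_EFinP; apply: measurable_indic; exact: measurable_ball.
rewrite integral_indic//; last exact: measurable_ball.
rewrite setIT [X in (_ * X)%E](_ : _ = (r *+ 2)%:E); last first.
  by apply: lebesgue_measure_ball; exact: ltW.
rewrite -EFinM lee_fin /L exprS le_eqVlt; apply/orP; left; apply/eqP; ring.
Qed.

Section measurability.
Context (R : realType) (d : nat).
Implicit Types x : 'rV[R]_d.

(** A countable base of the topology, through which open sets become countable unions. *)
Definition rat_ball (pn : 'rV[rat]_d * nat) : set 'rV[R]_d :=
  ball (map_mx ratr pn.1 : 'rV[R]_d) (pn.2.+1%:R^-1).

Lemma open_measurable_rV (A : set 'rV[R]_d) : open A -> measurable A.
Proof. by move=> oA; apply: sub_sigma_algebra. Qed.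

Lemma closed_measurable_rV (A : set 'rV[R]_d) : closed A -> measurable A.
Proof.
move=> cA; rewrite -(setCK A); apply: measurableC; apply: open_measurable_rV.
exact: closed_openC.
Qed.

Lemma measurable_ball_rV x (r : R) : 0 < r -> measurable (ball x r).
Proof. by move=> r0; apply: open_measurable_rV; exact: ball_open. Qed.

Lemma rat_ball_nbhs x (r : R) : 0 < r ->
  exists pn, rat_ball pn x /\ rat_ball pn `<=` ball x r.
Proof.
move=> r0; pose n := Num.truncn (2 / r).
have n0 : 0 < n.+1%:R^-1 :> R by rewrite invr_gt0.
have nr : n.+1%:R^-1 *+ 2 <= r.
  have : 2 / r < n.+1%:R by have /andP[] : n%:R <= 2 / r < n.+1%:R by apply: truncn_itv; rewrite divr_ge0// ltW.
  by rewrite ltr_pdivrMr// => /ltW h; rewrite -[leLHS]mulr_natl ler_pdivrMr ?ltr0n// mulrC.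
have hp j : exists q : rat, `|ratr q - x ord0 j| < n.+1%:R^-1.
  have /rat_in_itvoo[q] : x ord0 j < x ord0 j + n.+1%:R^-1 by rewrite ltrDl.
  rewrite in_itv /= => /andP[h1 h2]; exists q.
  by rewrite gtr0_norm ?subr_gt0// ltrBlDl.
have [p hp'] := choice hp.
have px : ball (map_mx ratr (\row_j p j) : 'rV[R]_d) (n.+1%:R^-1) x.
  by apply/ball_rV => // j; rewrite !mxE.
exists (\row_j p j, n); split => // y py; apply: (le_ball nr).
by rewrite mulr2n; apply: ball_triangle py; exact: ball_sym.
Qed.

(** The sigma-algebra on pairs is generated by measurable rectangles; an open set is the countable
    union of the products of rational balls that it contains. *)
Lemma open_prod_measurable (A : set ('rV[R]_d * 'rV[R]_d)) : open A -> measurable A.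
Proof.
move=> oA.
pose I := (('rV[rat]_d * nat) * ('rV[rat]_d * nat))%type.
pose B (i : I) := rat_ball i.1 `*` rat_ball i.2.
pose F (k : nat) := if unpickle k is Some i then
   if `[< B i `<=` A >] then B i else set0 else set0.
have -> : A = \bigcup_k F k.
  apply/seteqP; split => [[x y] Axy|z [k _]]; last first.
    by rewrite /F; case: unpickle => // i; case: asboolP => // BA /BA.
  have [r r0 rA] : exists2 r, 0 < r & forall x' y', ball x r x' -> ball y r y' -> A (x', y').
    move: oA; rewrite openE => /(_ _ Axy) /nbhs_ballP[r r0 h]; exists r => // x' y' Bx By.
    by apply: h; split.
  have [p [px pr]] := rat_ball_nbhs x r0; have [q [qy qr]] := rat_ball_nbhs y r0.
  exists (pickle ((p, q) : I)) => //; rewrite /F pickleK.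
  case: asboolP => [_|]; first by split.
  by move=> nBA; exfalso; apply: nBA => -[x' y'] [/= /pr Bx /qr By]; exact: rA.
apply: bigcupT_measurable => k; rewrite /F; case: unpickle => // i.
by case: ifP => // _; apply: measurableX; apply: measurable_ball_rV; rewrite invr_gt0.
Qed.

Lemma closed_spt (mu : probability 'rV[R]_d R) : closed (spt mu).
Proof.
rewrite -openC openE => x /= nx.
have [r [r0 mr]] : exists r : R, 0 < r /\ ~ (0 < mu (ball x r))%E.
  apply: contrapT => H; apply: nx => r r0; apply: contrapT => h.
  by apply: H; exists r.
apply/nbhs_ballP; exists (r / 2) => /=; first by rewrite divr_gt0.
move=> y Bxy /(_ (r / 2)) h; apply: mr.
apply: lt_le_trans (h _) _; first by rewrite divr_gt0.
apply: le_measure; rewrite ?inE; try by apply: measurable_ball_rV; rewrite ?divr_gt0.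
by move=> z; exact: ball_split.
Qed.

Lemma measurable_spt (mu : probability 'rV[R]_d R) : measurable (spt mu).
Proof. by apply: closed_measurable_rV; exact: closed_spt. Qed.

(** Each point off the support lies in a rational ball of measure zero, and there are countably many
    of these. *)
Lemma spt_full (mu : probability 'rV[R]_d R) : mu (~` spt mu) = 0%E.
Proof.
apply/negligibleP; first by apply: measurableC; exact: measurable_spt.
pose F (k : nat) : set 'rV[R]_d := if unpickle k is Some i then
   if `[< mu (rat_ball i) = 0%E >] then rat_ball i else set0 else set0.
apply: (@negligibleS _ _ _ mu (\bigcup_k F k)).
  move=> x /= nx.
  have [r [r0 mr]] : exists r : R, 0 < r /\ ~ (0 < mu (ball x r))%E.
    apply: contrapT => H; apply: nx => r r0; apply: contrapT => h.
    by apply: H; exists r.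
  have [p [px pr]] := rat_ball_nbhs x r0.
  exists (pickle p) => //; rewrite /F pickleK; case: asboolP => // h; exfalso; apply: h.
  apply/eqP; rewrite eq_le measure_ge0 andbT.
  apply: (@le_trans _ _ (mu (ball x r))); last by rewrite leNgt; exact/negP.
  by apply: le_measure; rewrite ?inE//; apply: measurable_ball_rV; rewrite ?invr_gt0.
apply: negligible_bigcup => k; rewrite /F; case: unpickle => [i|]; last exact: negligible_set0.
case: asboolP => [h|_]; last exact: negligible_set0.
apply/negligibleP => //; apply: measurable_ball_rV; by rewrite invr_gt0.
Qed.
End measurability.

(** A ball is a sup-norm cube of side [2 r], whence a factor [2 ^+ d] on the bound of the
    density. *)
Lemma Linf_ball (R : realType) (d : nat) (mu : probability 'rV[R]_d R) :
  abs_cont_Linf mu -> exists2 M : R, 0 <= M &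
    forall x r, 0 < r -> (mu (ball x r) <= (M * r ^+ d)%:E)%E.
Proof.
move=> [f [mf [M fM] muE]].
have M0 : 0 <= M by have /andP[h1 h2] := fM 0; exact: le_trans h1 h2.
exists (M * 2 ^+ d); first by rewrite mulr_ge0.
move=> x r r0; rewrite muE; last exact: measurable_ball_rV.
rewrite -mulrA -exprMn; apply: (@leb_int_box _ _ _ x) => //.
  move=> t; have /andP[h1 h2] := fM t; rewrite !lee_fin indicE; case: (t \in _).
    by rewrite mulr1 h1.
  by rewrite mulr0 lexx.
move=> t j h; rewrite indicE memNset ?mulr0//= => /(ball_rV _ _ r0)/(_ j).
by rewrite ltNge h.
Qed.

(** * Integrals and entropy over finite partitions *)

Definition cells d (T : measurableType d) (K : finType) (W : K -> set T) :=
  [/\ forall k, measurable (W k), trivIset setT W & forall z, exists k, W k z].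

Section cells.
Context d (T : measurableType d) (R : realType) (K : finType) (W : K -> set T).
Hypothesis cW : cells W.
Implicit Types (P : probability T R) (v : K -> R).

Let mW k : measurable (W k). Proof. by case: cW. Qed.

Definition mass P (k : K) : R := fine (P (W k)).

Lemma massE P k : P (W k) = (mass P k)%:E.
Proof. by rewrite fineK// fin_num_measure. Qed.

Lemma mass_ge0 P k : 0 <= mass P k.
Proof. by rewrite fine_ge0. Qed.

Lemma integral_cellsE P A (f : T -> R) : measurable A -> measurable_fun A f ->
  (\int[P]_(z in A) (f z)%:E = \sum_k \int[P]_(z in A `&` W k) (f z)%:E)%E.
Proof.
move=> mA mf; have [_ tW covW] := cW.
have AE : A = \big[setU/set0]_(k <- index_enum K) (A `&` W k).
  rewrite -big_distrr /= -bigcup_seq; apply/seteqP; split => [z Az|z []//].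
  by split => //; have [k Wk] := covW z; exists k => //=; rewrite mem_index_enum.
rewrite [in LHS]AE integral_bigsetU_EFin//.
- by move=> k; exact: measurableI.
- exact: index_enum_uniq.
- apply/trivIsetP => i j _ _ ij; rewrite setIACA.
  by move/trivIsetP : tW => ->//; rewrite setI0.
- by rewrite -AE; apply/measurable_EFinP.
Qed.

Lemma integral_EFin_cst P A (a : R) : measurable A ->
  (\int[P]_(z in A) a%:E = a%:E * P A)%E.
Proof. by move=> mA; exact: integral_cst. Qed.

Lemma measure_cellsE P A : measurable A -> (P A = \sum_k P (A `&` W k))%E.
Proof.
move=> mA; have := @integral_cellsE P A (cst 1) mA (measurable_cst _).
rewrite /= integral_EFin_cst// mul1e => ->; apply: eq_bigr => k _.
by rewrite integral_EFin_cst ?mul1e//; exact: measurableI.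
Qed.

Lemma mass_sum1 P : \sum_k mass P k = 1.
Proof.
have := measure_cellsE P measurableT; rewrite probability_setT.
under eq_bigr do rewrite setTI massE.
by rewrite sumEFin => -[].
Qed.

Definition step v (z : T) : R := \sum_k v k * \1_(W k) z.

Lemma stepE v k z : W k z -> step v z = v k.
Proof.
move=> Wz; rewrite /step (bigD1 k)//= indicE mem_set// mulr1 big1 ?addr0// => j jk.
rewrite indicE memNset ?mulr0// => Wjz; have [_ tW _] := cW.
by have := tW j k I I; case/(_ (ex_intro _ z (conj Wjz Wz))); apply/eqP.
Qed.

Lemma measurable_step v D : measurable_fun D (step v).
Proof.
apply: measurable_funTS; apply: measurable_sum => k.
apply: measurable_funM => //; exact: measurable_indic.
Qed.

Lemma integral_step P v A : measurable A ->
  (\int[P]_(z in A) (step v z)%:E = \sum_k (v k)%:E * P (A `&` W k))%E.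
Proof.
move=> mA; rewrite integral_cellsE//; last exact: measurable_step.
apply: eq_bigr => k _; rewrite -integral_EFin_cst; last exact: measurableI.
by apply: eq_integral => z /set_mem[_ Wz]; rewrite (stepE v Wz).
Qed.

(** [f] is controlled only on the full-measure set [X], where it is bounded and therefore
    integrable; each cell is compared with a constant, and the errors, [eta] times the mass of the
    cell, add up to [eta]. *)
Lemma integral_cells_approx P (D X : set T) (f : T -> R) v (eta : R) :
  measurable D -> measurable X -> X `<=` D -> P (~` X) = 0%E ->
  measurable_fun D f -> 0 <= eta ->
  (forall k z, W k z -> X z -> `|f z - v k| <= eta) ->
  exists2 r : R, (\int[P]_(z in D) (f z)%:E = r%:E)%E &
    `|r - \sum_k v k * mass P k| <= eta.
Proof.
move=> mD mX XD PX mf eta0 fv.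
have mXf : measurable_fun X f by exact: measurable_funS mf.
have PXD : P (D `\` X) = 0%E.
  by apply: (subset_measure0 (measurableD mD mX) (measurableC mX) _ PX) => z [].
have PWX k : P (X `&` W k) = (mass P k)%:E.
  have h : P (W k `\` X) = 0%E.
    by apply: (subset_measure0 (measurableD (mW k) mX) (measurableC mX) _ PX) => z [].
  have -> : (mass P k)%:E = P (W k `&` X `|` W k `\` X) by rewrite setUIDK massE.
  rewrite measureU; [|exact: measurableI|exact: measurableD|].
    by rewrite [X in (_ + X)%E](_ : _ = 0%E) ?adde0 1?setIC//; exact: h.
  by apply/seteqP; split => z //= [[_ ?] [_]].
have Plty A : measurable A -> (P A < +oo)%E.
  by move=> mA; apply: (le_lt_trans (probability_le1 P mA)); rewrite ltry.
have intXk k : P.-integrable (X `&` W k) (EFin \o f).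
  apply: measurable_bounded_integrable; first exact: measurableI.
  - by apply: Plty; exact: measurableI.
  - by apply: measurable_funS mXf.
  - exists (`|v k| + eta); split; first exact: num_real.
    move=> M hM z /= [Xz Wz]; apply: le_trans (ltW hM).
    rewrite -[f z](subrK (v k)) addrC; apply: le_trans (ler_normD _ _) _.
    by rewrite lerD2l; exact: fv Wz Xz.
have fX : forall z, X z -> `|f z| <= (\sum_k `|v k|) + eta.
  move=> z Xz; have [_ _ /(_ z)[k Wz]] := cW.
  rewrite -[f z](subrK (v k)) addrC; apply: le_trans (ler_normD _ _) _.
  apply: lerD; last exact: fv Wz Xz.
  by rewrite (bigD1 k)//= lerDl sumr_ge0.
have intX : P.-integrable X (EFin \o f).
  apply: measurable_bounded_integrable => //.
    exact: Plty.
  exists ((\sum_k `|v k|) + eta); split; first exact: num_real.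
  by move=> M hM z /= Xz; apply: le_trans (ltW hM); exact: fX.
have intD : P.-integrable D (EFin \o f).
  rewrite (negligible_integrable (measurableD mD mX))//; last exact/measurable_EFinP.
  by rewrite setDD setIidr.
have -> : (\int[P]_(z in D) (f z)%:E = \int[P]_(z in X) (f z)%:E)%E.
  rewrite (negligible_integral (measurableD mD mX))//.
  by rewrite setDD setIidr.
have bnd k : exists2 r : R, (\int[P]_(z in X `&` W k) (f z)%:E = r%:E)%E &
    `|r - v k * mass P k| <= eta * mass P k.
  have mXW : measurable (X `&` W k) by exact: measurableI.
  have ic (a : R) : P.-integrable (X `&` W k) (EFin \o cst a).
    apply: measurable_bounded_integrable => //; first exact: Plty.
    by exists `|a|; split; [exact: num_real|move=> M hM z _ /=; exact: ltW].
  have icE (a : R) : (\int[P]_(z in X `&` W k) (EFin \o cst a) z = (a * mass P k)%:E)%E.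
    by rewrite /= integral_EFin_cst// PWX.
  have h1 : (((v k - eta) * mass P k)%:E <= \int[P]_(z in X `&` W k) (f z)%:E)%E.
    rewrite -icE; apply: le_integral => // z /set_mem[Xz Wz]; rewrite lee_fin /=.
    by have := fv _ _ Wz Xz; rewrite ler_norml => /andP[? ?]; lra.
  have h2 : (\int[P]_(z in X `&` W k) (f z)%:E <= ((v k + eta) * mass P k)%:E)%E.
    rewrite -icE; apply: le_integral => // z /set_mem[Xz Wz]; rewrite lee_fin /=.
    by have := fv _ _ Wz Xz; rewrite ler_norml => /andP[? ?]; lra.
  have fin : (\int[P]_(z in X `&` W k) (f z)%:E)%E \is a fin_num.
    exact: integrable_fin_num.
  exists (fine (\int[P]_(z in X `&` W k) (f z)%:E)%E); first by rewrite fineK.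
  move: h1 h2; rewrite -(fineK fin) !lee_fin /= mulrBl mulrDl => h1 h2.
  by rewrite ler_norml; apply/andP; split; lra.
rewrite integral_cellsE//.
have {}bnd k : {r : R | (\int[P]_(z in X `&` W k) (f z)%:E = r%:E)%E &
    `|r - v k * mass P k| <= eta * mass P k} by apply: cid2; exact: bnd.
exists (\sum_k s2val (bnd k)).
  by rewrite -sumEFin; apply: eq_bigr => k _; exact: (s2valP (bnd k)).
rewrite -sumrB; apply: le_trans (ler_norm_sum _ _ _) _.
rewrite -[leRHS]mulr1 -(mass_sum1 P) mulr_sumr; apply: ler_sum => k _.
exact: (s2valP' (bnd k)).
Qed.
End cells.

(** [f] may fail to be integrable, so positive and negative parts are compared separately. *)
Lemma integral_ge_integrable d (T : measurableType d) (R : realType)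
  (mu : {measure set T -> \bar R}) (D : set T) (h f : T -> \bar R) :
  measurable D -> mu.-integrable D h -> measurable_fun D f ->
  (forall x, D x -> (h x <= f x)%E) ->
  (\int[mu]_(x in D) h x <= \int[mu]_(x in D) f x)%E.
Proof.
move=> mD ih mf hf.
have {}hf : {in D, forall x, (h x <= f x)%E} by move=> x /set_mem; exact: hf.
rewrite integralE [leRHS]integralE leeB//.
- apply: ge0_le_integral => //.
  + by move/integrableP : ih => [+ _]; exact: measurable_funepos.
  + exact: measurable_funepos.
  + by move=> x /mem_set; exact: funepos_le.
- apply: ge0_le_integral => //.
  + exact: measurable_funeneg.
  + by move/integrableP : ih => [+ _]; exact: measurable_funeneg.
  + by move=> x /mem_set; exact: funeneg_le.
Qed.

(** Young's inequality for [t ln t], whose convex conjugate at [g + 1] is [e^g]; it follows from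
    [1 + s <= e^s] at [s = g - ln t]. *)
Lemma xlnx_ge (R : realType) (t g : R) : 0 <= t ->
  t * (g + 1) - expR g <= t * ln t.
Proof.
rewrite le_eqVlt => /predU1P[<-|t0].
  by rewrite !mul0r sub0r oppr_le0 expR_ge0.
have h := expR_ge1Dx (g - ln t).
have : t * (1 + (g - ln t)) <= t * expR (g - ln t) by rewrite ler_pM2l.
rewrite expRD expRN lnK ?posrE// mulrCA divff ?gt_eqF// mulr1; lra.
Qed.

(** Gibbs' inequality with a test function constant on cells: integrate [xlnx_ge] with [g = G k] on
    each cell. The extra masses of [Q] total one and pay for the exponential terms. The density
    [rho] may vary inside a cell. *)
Lemma entropy_ge_cells d (T : measurableType d) (R : realType) (K : finType)
  (W : K -> set T) (P Q : probability T R) (rho : T -> R) (G : K -> R) :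
  cells W -> measurable_fun setT rho -> (forall z, 0 <= rho z) ->
  (forall A, measurable A -> Q A = \int[P]_(z in A) (rho z)%:E)%E ->
  \sum_k expR (G k) * mass W P k <= 1 ->
  ((\sum_k G k * mass W Q k)%:E <= \int[P]_z (rho z * ln (rho z))%:E)%E.
Proof.
move=> cW mrho rho0 QE sG; have [mW _ _] := cW.
have mrl : measurable_fun setT (fun z => rho z * ln (rho z)).
  by apply: measurable_funM => //; apply: measurableT_comp => //; exact: measurable_ln.
rewrite (integral_cellsE cW)//.
apply: (@le_trans _ _ (\sum_k ((G k + 1) * mass W Q k - expR (G k) * mass W P k)%:E)%E).
  rewrite sumEFin lee_fin sumrB; under [X in X - _]eq_bigr do rewrite mulrDl mul1r.
  by rewrite big_split /= mass_sum1// -addrA lerDl subr_ge0.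
apply: lee_sum => k _; rewrite setTI.
have ir : P.-integrable (W k) (EFin \o rho).
  apply/integrableP; split; first by apply/measurable_EFinP; exact: measurable_funTS.
  under eq_integral do rewrite /= ger0_norm//.
  by rewrite -QE// massE// ltry.
have ic : P.-integrable (W k) (EFin \o cst (expR (G k))).
  apply: measurable_bounded_integrable => //.
    by apply: (le_lt_trans (probability_le1 P (mW k))); rewrite ltry.
  by exists `|expR (G k)|; split; [exact: num_real|move=> M hM z _ /=; exact: ltW].
have irz : P.-integrable (W k) (fun z => (G k + 1)%:E * (rho z)%:E)%E.
  exact: integrableZl.
apply: (@le_trans _ _ (\int[P]_(z in W k) ((G k + 1)%:E * (rho z)%:E - (EFin \o cst (expR (G k))) z))%E).
  rewrite integralB// integralZl// -QE// /= integral_EFin_cst//.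
  by rewrite !massE// -!EFinM -EFinB.
apply: integral_ge_integrable => //.
- exact: integrableB.
- by apply/measurable_EFinP; exact: measurable_funTS.
- move=> z _; rewrite -EFinM -EFinB lee_fin mulrC; exact: xlnx_ge.
Qed.

Section density_measure.
Context d (T : measurableType d) (R : realType) (P : probability T R).
Variable rho : {f : T -> R | [/\ measurable_fun setT f, forall z, 0 <= f z &
  (\int[P]_z (f z)%:E = 1)%E]}.
Local Open Scope ereal_scope.

(** The density comes bundled with its properties in [rho], so that the measure and probability
    structures can be attached to this function. *)
Definition density_measure (A : set T) : \bar R := \int[P]_(z in A) (sval rho z)%:E.

Let m0 : density_measure set0 = 0.
Proof. by rewrite /density_measure integral_set0. Qed.

Let m_ge0 A : 0 <= density_measure A.
Proof.
by rewrite /density_measure; case: rho => f [mf f0 f1] /=; apply: integral_ge0 => z _; rewrite lee_fin.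
Qed.

Let m_sigma : semi_sigma_additive density_measure.
Proof.
move=> /= A mA tA mUA; rewrite /density_measure; case: rho => f [mf f0 f1] /=.
rewrite ge0_integral_bigcup//=.
- apply: is_cvg_ereal_nneg_natsum_cond => n _ _.
  by apply: integral_ge0 => /= x ?; rewrite lee_fin.
- by apply/measurable_EFinP; exact: measurable_funTS.
- by move=> z _; rewrite lee_fin.
Qed.

HB.instance Definition _ := isMeasure.Build _ _ _ density_measure m0 m_ge0 m_sigma.

Let mT : density_measure setT = 1.
Proof. by rewrite /density_measure; case: rho => f [mf f0 f1]. Qed.

HB.instance Definition _ := @Measure_isProbability.Build _ _ R density_measure mT.
End density_measure.

Lemma cells_probability d (T : measurableType d) (R : realType) (K : finType)
  (W : K -> set T) (P : probability T R) (w : K -> R) :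
  cells W -> (forall k, 0 <= w k) -> \sum_k w k = 1 ->
  (forall k, mass W P k = 0 -> w k = 0) ->
  exists Q : probability T R,
    (forall A, measurable A ->
      Q A = \int[P]_(z in A) (step W (fun k => w k / mass W P k) z)%:E)%E /\
    forall k, mass W Q k = w k.
Proof.
move=> cW w0 w1 wP; have [mW tW _] := cW; pose r k := w k / mass W P k.
have r0 z : 0 <= step W r z.
  by apply: sumr_ge0 => k _; rewrite mulr_ge0// divr_ge0// mass_ge0.
(* On a cell that is null for [P] the quotient is zero by convention, and so is [w k] by
   hypothesis. *)
have rK k : r k * mass W P k = w k.
  rewrite /r; have [P0|P0] := eqVneq (mass W P k) 0; first by rewrite wP// !mul0r.
  by rewrite divfK.
have i1 : (\int[P]_z (step W r z)%:E = 1)%E.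
  rewrite integral_step//.
  under eq_bigr do rewrite setTI massE// -EFinM rK.
  by rewrite sumEFin w1.
have ms : measurable_fun setT (step W r) by exact: measurable_step.
exists (density_measure (exist _ (step W r) (And3 ms r0 i1))).
split=> // k; rewrite /mass /= /density_measure /= integral_step//.
rewrite (bigD1 k)//= setIid massE// -EFinM rK big1 ?adde0// => j jk.
move/trivIsetP : tW => ->//; last by rewrite eq_sym.
by rewrite measure0 mule0.
Qed.

(** * Discretising couplings *)

Lemma spt_nonempty (R : realType) (d : nat) (mu : probability 'rV[R]_d R) :
  spt mu !=set0.
Proof.
apply/set0P/eqP => s0; have := spt_full mu; rewrite s0 setC0 probability_setT.
by move/eqP; rewrite onee_eq0.
Qed.

Lemma spt_partition (R : realType) (d : nat) (mu : probability 'rV[R]_d R) (h : R) :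
  compact (spt mu) -> 0 < h ->
  exists (n : nat) (p : 'I_n -> 'rV[R]_d) (A : 'I_n -> set 'rV[R]_d),
    [/\ cells A, forall i, spt mu (p i) &
        forall i x, A i x -> spt mu x -> ball (p i) h x].
Proof.
move=> cX h0; have [x0 Xx0] := spt_nonempty mu.
pose Q (S : set 'rV[R]_d) := exists s : seq 'rV[R]_d,
  (forall p, p \in s -> spt mu p) /\ forall x, S x -> exists2 p, p \in s & ball p h x.
have [|S1 S2|S1 S2|x Xx|s [sX sc]] := @compact_induction _ _ Q cX.
- by exists [::].
- move=> [s1 [h1 c1]] [s2 [h2 c2]]; exists (s1 ++ s2); split => [p|x].
    by rewrite mem_cat => /orP[/h1|/h2].
  by case=> [/c1|/c2][p ps Bp]; exists p => //; rewrite mem_cat ps ?orbT.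
- by move=> S12 [s [sX sc]]; exists s; split => // x /S12 /sc.
- exists (ball x h); first exact: nbhsx_ballx.
  by exists [:: x]; split => [p|y By]; [rewrite inE => /eqP ->|exists x; rewrite ?mem_head].
(* The whole space is appended after the balls so that the disjoint pieces cover everything; coming
   last, it keeps only what the balls leave out, hence no point of the support, and its
   representative is the default [x0]. *)
pose C (i : nat) : set 'rV[R]_d := if (i < size s)%N then ball (nth x0 s i) h else setT.
have mC i : measurable (C i).
  by rewrite /C; case: ifP => _; [exact: measurable_ball_rV|exact: measurableT].
pose n := (size s).+1.
exists n, (fun i => nth x0 s i), (fun i => seqDU C i); split.
- split.
  + move=> i; rewrite /seqDU; apply: measurableD => //.
    exact: bigsetU_measurable.
  + apply/trivIsetP => i j _ _ ij; have tC := trivIset_seqDU C; by move/trivIsetP : tC; apply.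
  + move=> z; have : (\big[setU/set0]_(k < n) C k) z.
      by rewrite big_ord_recr /=; right; rewrite /C ltnn.
    by rewrite bigsetU_seqDU -bigcup_mkord => -[k /= kn Ck]; exists (Ordinal kn).
- move=> i; have [is_|is_] := ltnP i (size s); last by rewrite nth_default.
  by apply: sX; exact: mem_nth.
- move=> i x [Cx nC] Xx; move: Cx; rewrite /C; case: ifPn => // is_ _.
  exfalso; apply: nC; have [p ps Bp] := sc _ Xx.
  have ps' : (index p s < i)%N.
    by rewrite (leq_trans (n := size s)) ?index_mem// leqNgt.
  rewrite -bigcup_mkord; exists (index p s) => //=.
  by rewrite /C index_mem ps nth_index.
Qed.

Lemma cells_prod d1 d2 (T1 : measurableType d1) (T2 : measurableType d2)
  (I J : finType) (A : I -> set T1) (B : J -> set T2) :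
  cells A -> cells B -> cells (fun ij : I * J => A ij.1 `*` B ij.2).
Proof.
move=> [mA tA cA] [mB tB cB]; split.
- by move=> [i j]; apply: measurableX; [exact: mA|exact: mB].
- move=> [i j] [i' j'] _ _ [[x y] [/= [Ax By] [Ax' By']]].
  have -> : i = i' by apply: tA => //; exists x.
  by have -> : j = j' by apply: tB => //; exists y.
- move=> [x y]; have [i Ai] := cA x; have [j Bj] := cB y.
  by exists (i, j); split.
Qed.

Lemma product_fineE d1 d2 (T1 : measurableType d1) (T2 : measurableType d2)
  (R : realType) (P : probability T1 R) (Q : probability T2 R) C D :
  measurable C -> measurable D ->
  (P \x Q)%E (C `*` D) = (fine (P C) * fine (Q D))%:E.
Proof.
by move=> mC mD; rewrite product_measure1E// EFinM !fineK//; apply: fin_num_measure.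
Qed.

Lemma mass_prod d1 d2 (T1 : measurableType d1) (T2 : measurableType d2)
  (R : realType) (P : probability T1 R) (Q : probability T2 R)
  (I J : finType) (A : I -> set T1) (B : J -> set T2) i j :
  cells A -> cells B ->
  mass (fun ij : I * J => A ij.1 `*` B ij.2) (P \x Q)%E (i, j) = mass A P i * mass B Q j.
Proof.
move=> cA cB; have [mA _ _] := cA; have [mB _ _] := cB.
by rewrite {1}/mass /= product_fineE.
Qed.

Section discretization.
Context (R : realType) (d : nat) (mum mup : probability 'rV[R]_d R).
Variables (I J : finType) (A : I -> set 'rV[R]_d) (B : J -> set 'rV[R]_d).
Hypotheses (cA : cells A) (cB : cells B).
Let W (ij : I * J) := A ij.1 `*` B ij.2.
Let a := mass A mum.
Let b := mass B mup.

Lemma coupling_mass g : coupling mum mup g ->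
  fin_coupling a b (fun i j => mass W g (i, j)).
Proof.
move=> [_ gA gB]; have cW := cells_prod cA cB; have [mA tA _] := cA; have [mB tB _] := cB.
have mAT i : measurable (A i `*` [set: 'rV[R]_d]) by apply: measurableX.
have mTB j : measurable ([set: 'rV[R]_d] `*` B j) by apply: measurableX.
split=> [i j|i|j]; first exact: mass_ge0.
- apply/EFin_inj; rewrite -sumEFin /a -massE// -gA// (measure_cellsE cW)//.
  rewrite (eq_bigr (fun ij : I * J => if ij.1 == i then g (W ij) else 0%E)); last first.
    move=> [i' j'] _ /=; rewrite /W /= -setXI setTI; case: eqVneq => [->|ii].
      by rewrite setIid.
    rewrite (trivIsetP.1 tA)//; last by rewrite eq_sym.
    by rewrite set0X measure0.
  rewrite -(pair_big xpredT xpredT (fun i' j => if i' == i then g (W (i', j)) else 0%E)) /=.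
  rewrite (bigD1 i)//= eqxx [X in _ = (_ + X)%E]big1 ?adde0.
    by apply: eq_bigr => j _; rewrite (massE cW).
  by move=> i' /negPf ->; rewrite big1.
- apply/EFin_inj; rewrite -sumEFin /b -massE// -gB// (measure_cellsE cW)//.
  rewrite (eq_bigr (fun ij : I * J => if ij.2 == j then g (W ij) else 0%E)); last first.
    move=> [i' j'] _ /=; rewrite /W /= -setXI setTI; case: eqVneq => [->|jj].
      by rewrite setIid.
    rewrite (trivIsetP.1 tB)//; last by rewrite eq_sym.
    by rewrite setX0 measure0.
  rewrite -(pair_big xpredT xpredT (fun i j' => if j' == j then g (W (i, j')) else 0%E)) /=.
  rewrite exchange_big /= (bigD1 j)//= eqxx [X in _ = (_ + X)%E]big1 ?adde0.
    by apply: eq_bigr => i _; rewrite (massE cW).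
  by move=> j' /negPf ->; rewrite big1.
Qed.

Let r (w : I -> J -> R) (ij : I * J) := w ij.1 ij.2 / (a ij.1 * b ij.2).

(** Each cell receives the constant density [w i j / (a i * b j)] with respect to the product
    measure. The conditional laws of [mum] in [A i] and of [mup] in [B j] are untouched, so the
    marginals are right, and the entropy reduces to the finite sum. *)
Lemma fin_coupling_lift w : fin_coupling a b w ->
  exists g : probability ('rV[R]_d * 'rV[R]_d)%type R,
  [/\ coupling mum mup g, forall i j, mass W g (i, j) = w i j &
    (rel_ent mum mup g <= (\sum_i \sum_j w i j * ln (w i j / (a i * b j)))%:E)%E].
Proof.
move=> [w0 wa wb]; have cW := cells_prod cA cB; have [mA tA _] := cA; have [mB tB _] := cB.
pose P := (mum \x mup)%E.
have mP i j : mass W P (i, j) = a i * b j by exact: mass_prod.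
have a0 i : 0 <= a i by exact: mass_ge0.
have b0 j : 0 <= b j by exact: mass_ge0.
have w_a i j : a i = 0 -> w i j = 0.
  move=> ai; move: (wa i); rewrite ai => /psumr_eq0P; apply => // j' _; exact: w0.
have w_b i j : b j = 0 -> w i j = 0.
  move=> bj; move: (wb j); rewrite bj => /psumr_eq0P; apply => // i' _; exact: w0.
have [|||g [gE gw]] := @cells_probability _ _ R _ W P (fun ij => w ij.1 ij.2) cW.
- by case=> i j; exact: w0.
- rewrite -(pair_big xpredT xpredT w) /=; under eq_bigr do rewrite wa.
  exact: mass_sum1.
- move=> [i j]; rewrite mP => /eqP; rewrite mulf_eq0 => /orP[]/eqP; [exact: w_a|exact: w_b].
have gE' C : measurable C ->
    g C = (\sum_i \sum_j (r w (i, j))%:E * P (C `&` W (i, j)))%E.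
  move=> mC; rewrite gE// integral_step//.
  rewrite -(pair_big xpredT xpredT (fun i j => (w i j / mass W P (i, j))%:E * P (C `&` W (i, j)))%E) /=.
  by apply: eq_bigr => i _; apply: eq_bigr => j _; rewrite mP.
have gA C : measurable C -> g (C `*` setT) = mum C.
  move=> mC; have mCA i : measurable (C `&` A i) by exact: measurableI.
  rewrite gE'; last exact: measurableX.
  rewrite (measure_cellsE cA)//; apply: eq_bigr => i _.
  pose x := fine (mum (C `&` A i)).
  have xE : mum (C `&` A i) = x%:E by rewrite fineK// fin_num_measure.
  have x0 : 0 <= x by rewrite fine_ge0.
  have xa : a i = 0 -> x = 0.
    move=> ai; apply/eqP; rewrite eq_le x0 andbT -ai -lee_fin -xE /a -massE//.
    by apply: le_measure; rewrite ?inE.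
  (* Inside [A i] the set [C] takes the fraction [x / a i] of the mass, and row [i] of [w] sums to
     [a i]. *)
  transitivity (\sum_j (w i j * (x / a i))%:E)%E.
    apply: eq_bigr => j _; rewrite /W /= -setXI setTI /P product_fineE// -EFinM; congr EFin.
    rewrite -/(x) -/(mass _ _ _) /r /= -/(a i) -/(b j).
    have [bj|bj] := eqVneq (b j) 0; first by rewrite w_b// !mul0r.
    have [ai|ai] := eqVneq (a i) 0; first by rewrite w_a// !mul0r.
    by rewrite -/b; field; rewrite ai bj.
  rewrite sumEFin -mulr_suml wa xE; congr EFin.
  by have [ai|ai] := eqVneq (a i) 0; [rewrite xa// ai mul0r|rewrite mulrC divfK].
have gB C : measurable C -> g (setT `*` C) = mup C.
  move=> mC; have mCB j : measurable (C `&` B j) by exact: measurableI.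
  rewrite gE'; last exact: measurableX.
  rewrite exchange_big (measure_cellsE cB)//; apply: eq_bigr => j _.
  pose x := fine (mup (C `&` B j)).
  have xE : mup (C `&` B j) = x%:E by rewrite fineK// fin_num_measure.
  have x0 : 0 <= x by rewrite fine_ge0.
  have xb : b j = 0 -> x = 0.
    move=> bj; apply/eqP; rewrite eq_le x0 andbT -bj -lee_fin -xE /b -massE//.
    by apply: le_measure; rewrite ?inE.
  transitivity (\sum_i (w i j * (x / b j))%:E)%E.
    apply: eq_bigr => i _; rewrite /W /= -setXI setTI /P product_fineE// -EFinM; congr EFin.
    rewrite -/(x) -/(mass _ _ _) /r /= -/(a i) -/(b j).
    have [bj|bj] := eqVneq (b j) 0; first by rewrite w_b// !mul0r.
    have [ai|ai] := eqVneq (a i) 0; first by rewrite w_a// !mul0r.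
    by rewrite -/a; field; rewrite ai bj.
  rewrite sumEFin -mulr_suml wb xE; congr EFin.
  by have [bj|bj] := eqVneq (b j) 0; [rewrite xb// bj mul0r|rewrite mulrC divfK].
have mXm := measurable_spt mum; have mXp := measurable_spt mup.
exists g; split=> //.
  split=> //.
  have g1 : g ((~` spt mum) `*` setT) = 0%E by rewrite gA ?spt_full//; exact: measurableC.
  have g2 : g (setT `*` (~` spt mup)) = 0%E by rewrite gB ?spt_full//; exact: measurableC.
  have m1 : measurable ((~` spt mum) `*` [set: 'rV[R]_d]).
    by apply: measurableX => //; exact: measurableC.
  have m2 : measurable ([set: 'rV[R]_d] `*` (~` spt mup)).
    by apply: measurableX => //; exact: measurableC.
  (* The complement of the product of the supports lies in the union of two strips, each null by one
     of the marginal conditions. *)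
  apply: (@subset_measure0 _ _ _ g _ (((~` spt mum) `*` setT) `|` (setT `*` (~` spt mup)))).
  - by apply: measurableC; exact: measurableX.
  - exact: measurableU.
  - move=> [x y] /= nXY; have [Xx|nx] := pselect (spt mum x); last by left.
    by right; split => // Xy; apply: nXY.
  - exact: null_set_setU.
(* [rel_ent] is an infimum over densities, so one density bounds it from above. *)
rewrite /rel_ent; apply: ereal_inf_le.
pose rho := step W (fun ij : I * J => w ij.1 ij.2 / mass W P ij).
exists (\int[P]_z (rho z * ln (rho z))%:E)%E.
  exists rho => //; split => //; first exact: measurable_step.
  move=> z; apply: sumr_ge0 => -[i j] _; apply: mulr_ge0 => //.
  by apply: divr_ge0; [exact: w0|exact: mass_ge0].
pose rl (ij : I * J) := r w ij * ln (r w ij).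
rewrite (_ : (\int[P]_z (rho z * ln (rho z))%:E)%E = (\int[P]_z (step W rl z)%:E)%E); last first.
  apply: eq_integral => z _; congr EFin; have [_ _ /(_ z)[[i j] Wz]] := cW.
  by rewrite /rho !(stepE cW _ Wz) mP.
rewrite integral_step//.
rewrite -(pair_big xpredT xpredT (fun i j => (rl (i, j))%:E * P (setT `&` W (i, j)))%E) /=.
rewrite -sumEFin; apply: lee_sum => i _; rewrite -sumEFin; apply: lee_sum => j _.
rewrite setTI [X in (_ * X)%E](_ : _ = (a i * b j)%:E); last exact: product_fineE.
rewrite -EFinM lee_fin /rl /r /=.
have [bj|bj] := eqVneq (b j) 0; first by rewrite w_b// !mul0r.
have [ai|ai] := eqVneq (a i) 0; first by rewrite w_a// !mul0r.
rewrite le_eqVlt; apply/orP; left; apply/eqP; move: (ln _) => l; field.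
by rewrite ai bj.
Qed.
End discretization.

Section cost.
Context (R : realType) (d : nat) (Om Op : set 'rV[R]_d)
  (c : 'rV[R]_d -> 'rV[R]_d -> R).

Lemma cost_measurable : open Om -> open Op -> cont_on Om Op c ->
  measurable_fun (Om `*` Op) (fun z : 'rV[R]_d * 'rV[R]_d => c z.1 z.2).
Proof.
move=> oOm oOp cc.
have mD : measurable (Om `*` Op) by apply: measurableX; exact: open_measurable_rV.
apply: (measurability _ (RGenOInfty.measurableE R)) => //.
move=> _ [_ [x ->] <-]; apply: open_prod_measurable.
rewrite openE => -[u v] [[/= Omu Opv]]; rewrite in_itv /= andbT => xc.
apply: filterI.
  by exists (Om, Op) => //; split; exact: open_nbhs_nbhs.
apply: (cc u v Omu Opv); apply: open_nbhs_nbhs; split; first exact: interval_open.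
by rewrite /= in_itv /= andbT.
Qed.

(** Uniform continuity by compact induction; only the base point [(x, y)] ranges over the compact
    set, the second point is any nearby one. *)
Lemma cost_uniform (Xm Xp : set 'rV[R]_d) (eta : R) :
  open Om -> open Op -> cont_on Om Op c ->
  compact Xm -> Xm `<=` Om -> compact Xp -> Xp `<=` Op -> 0 < eta ->
  exists2 h, 0 < h & forall x y x' y', Xm x -> Xp y -> ball x h x' -> ball y h y' ->
    `|c x' y' - c x y| <= eta.
Proof.
move=> oOm oOp cc cXm XmO cXp XpO eta0.
pose Q (S : set ('rV[R]_d * 'rV[R]_d)) := exists2 h, 0 < h &
  forall x y x' y', S (x, y) -> ball x h x' -> ball y h y' -> `|c x' y' - c x y| <= eta.
have [||||h h0 H] := @compact_induction _ _ Q (compact_setX cXm cXp); last first.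
- by exists h => // x y x' y' Xx Xy; apply: H.
- move=> [x0 y0] [/= Xx Xy]; have e2 : 0 < eta / 2 by rewrite divr_gt0.
  have /cvgrPdist_lt/(_ _ e2) := cc x0 y0 (XmO _ Xx) (XpO _ Xy).
  move=> /nbhs_prod_ball[r r0 Hr].
  have r2 : r / 2 <= r by rewrite ler_pdivrMr// ler_peMr ?ler1n// ltW.
  exists (ball x0 (r / 2) `*` ball y0 (r / 2)).
    exists (ball x0 (r / 2), ball y0 (r / 2)) => //.
    by split; apply: nbhsx_ballx; rewrite divr_gt0.
  exists (r / 2); first by rewrite divr_gt0.
  move=> x y x' y' [/= Bx By] Bx' By'.
  have h1 := Hr _ _ (ball_split Bx Bx') (ball_split By By').
  have h2 := Hr _ _ (le_ball r2 Bx) (le_ball r2 By).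
  move: h1 h2; rewrite !ltr_norml ler_norml /= => /andP[? ?] /andP[? ?].
  by apply/andP; split; lra.
- move=> S1 S2 S12 [h h0 H]; exists h => // x y x' y' Sxy; apply: H; exact: S12.
- move=> S1 S2 [h1 h10 H1] [h2 h20 H2]; exists (Num.min h1 h2).
    by rewrite lt_min h10.
  have m1 : Num.min h1 h2 <= h1 by rewrite ge_min lexx.
  have m2 : Num.min h1 h2 <= h2 by rewrite ge_min lexx orbT.
  move=> x y x' y' [Sxy|Sxy] Bx By.
    by apply: H1 Sxy (le_ball m1 Bx) (le_ball m1 By).
  by apply: H2 Sxy (le_ball m2 Bx) (le_ball m2 By).
- by exists 1.
Qed.
End cost.

Lemma transport_cost_cells (R : realType) (d : nat) (Om Op : set 'rV[R]_d)
  (mum mup : probability 'rV[R]_d R) (c : 'rV[R]_d -> 'rV[R]_d -> R)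
  (I J : finType) (A : I -> set 'rV[R]_d) (B : J -> set 'rV[R]_d)
  (v : I -> J -> R) (eta : R) g :
  open Om -> open Op -> cont_on Om Op c -> spt mum `<=` Om -> spt mup `<=` Op ->
  cells A -> cells B -> 0 <= eta ->
  (forall i j x y, A i x -> B j y -> spt mum x -> spt mup y ->
    `|c x y - v i j| <= eta) ->
  coupling mum mup g ->
  exists2 t : R, transport_cost Om Op c g = t%:E &
    `|t - \sum_i \sum_j mass (fun ij => A ij.1 `*` B ij.2) g (i, j) * v i j| <= eta.
Proof.
move=> oOm oOp cc XmO XpO cA cB eta0 cv [gX _ _].
have [|||||||t tE ht] := @integral_cells_approx _ _ _ _ _ (cells_prod cA cB) g
  (Om `*` Op) (spt mum `*` spt mup) (fun z => c z.1 z.2) (fun ij => v ij.1 ij.2) eta.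
- by apply: measurableX; exact: open_measurable_rV.
- by apply: measurableX; exact: measurable_spt.
- by move=> [x y] [/= /XmO ? /XpO ?].
- exact: gX.
- exact: cost_measurable.
- exact: eta0.
- by move=> [i j] [x y] [/= Ax By] [Xx Xy]; exact: cv.
exists t => //; move: ht.
under eq_bigr do rewrite mulrC.
by rewrite -(pair_big xpredT xpredT (fun i j => mass (fun ij : I * J => A ij.1 `*` B ij.2) g (i, j) * v i j)).
Qed.

(** * The two bounds *)

(** Up to a null set, a cell lies in the [h]-ball of its representative, so all the cells counted
    lie in one ball of radius [rad + h]. *)
Lemma mass_near (R : realType) (d : nat) (mu : probability 'rV[R]_d R)
  (I : finType) (A : I -> set 'rV[R]_d) (p : I -> 'rV[R]_d) (h rad M : R)
  (i0 : I) (S : pred I) :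
  cells A -> (forall i x, A i x -> spt mu x -> ball (p i) h x) ->
  (forall x r, 0 < r -> (mu (ball x r) <= (M * r ^+ d)%:E)%E) ->
  0 < h -> 0 <= rad -> (forall i, S i -> `|p i - p i0| <= rad) ->
  \sum_(i | S i) mass A mu i <= M * (rad + h) ^+ d.
Proof.
move=> cA Ap muM h0 rad0 Sp; have [mA _ _] := cA.
have r0 : 0 < rad + h by rewrite ltr_wpDl.
have mB := measurable_ball_rV (p i0) r0.
rewrite -lee_fin; apply: le_trans (muM (p i0) _ r0).
rewrite (measure_cellsE cA)// -sumEFin.
apply: (@le_trans _ _ (\sum_(i | S i) mu (ball (p i0) (rad + h) `&` A i))%E); last first.
  by rewrite [leRHS](bigID S)/= leeDl// sume_ge0.
apply: lee_sum => i Si; rewrite -massE//.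
apply: (@le_trans _ _ (mu ((ball (p i0) (rad + h) `&` A i) `|` ~` spt mu))).
  apply: le_measure; rewrite ?inE//.
    apply: measurableU; first exact: measurableI.
    by apply: measurableC; exact: measurable_spt.
  move=> x Ax; have [Xx|nx] := pselect (spt mu x); last by right.
  left; split => //; have := Ap _ _ Ax Xx; rewrite -!ball_normE /= => h1.
  rewrite -(subrK (p i) (p i0)) -addrA; apply: le_lt_trans (ler_normD _ _) _.
  by rewrite ler_ltD// distrC; exact: Sp.
apply: le_trans (measureU2 _ _ _) _; [exact: measurableI|by apply: measurableC; exact: measurable_spt|].
by rewrite [X in (_ + X)%E](_ : _ = 0%E) ?adde0//; exact: spt_full.
Qed.

(** The potentials cancel in a cross difference. When the slacks are nonnegative this bounds it
    above by the slacks at the two unswapped pairs. *)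
Lemma crossE (R : realType) (I J : finType) (T : Type) (c : T -> T -> R)
  (p : I -> T) (q : J -> T) (phi : I -> R) (psi : J -> R) i j i' j' :
  cross c (p i) (q j) (p i') (q j') =
  (c (p i) (q j) - phi i - psi j) + (c (p i') (q j') - phi i' - psi j')
  - (c (p i) (q j') - phi i - psi j') - (c (p i') (q j) - phi i' - psi j).
Proof. by rewrite /cross; ring. Qed.

Lemma sum1_pos (R : realType) (X : finType) (F : X -> R) : (forall x, 0 <= F x) ->
  \sum_x F x = 1 -> exists x, 0 < F x.
Proof.
move=> F0 F1; apply: contrapT => H; move/eqP: F1; rewrite big1 1?eq_sym ?oner_eq0// => x _.
apply/eqP; rewrite eq_le F0 andbT leNgt; apply/negP => Fx; by apply: H; exists x.
Qed.

Section assembly.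
Context (R : realType) (d : nat) (Om Op : set 'rV[R]_d)
  (mum mup : probability 'rV[R]_d R) (c : 'rV[R]_d -> 'rV[R]_d -> R).
Variables (I J : finType) (A : I -> set 'rV[R]_d) (B : J -> set 'rV[R]_d).
Variables (p : I -> 'rV[R]_d) (q : J -> 'rV[R]_d) (h : R).
Hypotheses (oOm : open Om) (oOp : open Op) (cc : cont_on Om Op c).
Hypotheses (XmO : spt mum `<=` Om) (XpO : spt mup `<=` Op).
Hypotheses (cA : cells A) (cB : cells B).
Hypotheses (Xp_ : forall i, spt mum (p i)) (Xq_ : forall j, spt mup (q j)).
Hypotheses (Ap : forall i x, A i x -> spt mum x -> ball (p i) h x).
Hypotheses (Bq : forall j x, B j x -> spt mup x -> ball (q j) h x).
Hypothesis h0 : 0 < h.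
Variables (Ccov K Mm Mp : R).
Hypotheses (Ccov0 : 0 <= Ccov) (K0 : 0 <= K) (Mm0 : 0 <= Mm) (Mp0 : 0 <= Mp).
Hypothesis cov : forall del, 0 < del <= 1 ->
    exists (T : finType) (k : 'rV[R]_d * 'rV[R]_d -> T),
      #|T|%:R <= Ccov / del ^+ d /\
      forall x y x' y', (spt mum `*` spt mup) (x, y) -> (spt mum `*` spt mup) (x', y') ->
        k (x, y) = k (x', y') ->
        cross c x y x' y' <= 2 * del ^+ 2 ->
        [/\ `|x - x'| <= K * del, `|y - y'| <= K * del &
            `|cross c x y x' y'| <= K * del ^+ 2].
Hypothesis mumM : forall x r, 0 < r -> (mum (ball x r) <= (Mm * r ^+ d)%:E)%E.
Hypothesis mupM : forall x r, 0 < r -> (mup (ball x r) <= (Mp * r ^+ d)%:E)%E.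

Let a := mass A mum.
Let b := mass B mup.
Let W (ij : I * J) := A ij.1 `*` B ij.2.
Let C i j := c (p i) (q j).

Let a0 i : 0 <= a i. Proof. exact: mass_ge0. Qed.
Let b0 j : 0 <= b j. Proof. exact: mass_ge0. Qed.
Let a1 : \sum_i a i = 1. Proof. exact: mass_sum1. Qed.
Let b1 : \sum_j b j = 1. Proof. exact: mass_sum1. Qed.

Let Cl := Ccov * (Mm * (K + 1) ^+ d * (Mp * (K + 1) ^+ d)).

(** Two pairs of the level set with equal label have cross difference at most [2 del^2], so each
    label occupies, up to null sets, a product of two balls of radius at most [(K + 1) del], of mass
    [O(del^(2d))]; there are at most [Ccov / del^d] labels. *)
Lemma level_bound (phi : I -> R) (psi : J -> R) (del : R) :
  (forall i j, phi i + psi j <= C i j) -> 0 < del <= 1 -> h <= del ->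
  \sum_(ij : I * J | C ij.1 ij.2 - phi ij.1 - psi ij.2 <= del ^+ 2) a ij.1 * b ij.2
    <= Cl * del ^+ d.
Proof.
move=> feas del01 hdel; have /andP[del0 del1] := del01.
have [T [k [cT hk]]] := cov del01.
pose kk (ij : I * J) := k (p ij.1, q ij.2).
rewrite (partition_big kk xpredT)//=.
pose X := Mm * ((K + 1) * del) ^+ d * (Mp * ((K + 1) * del) ^+ d).
have X0 : 0 <= X.
  by rewrite !mulr_ge0// exprn_ge0// mulr_ge0// ?addr_ge0// ltW.
apply: (@le_trans _ _ (\sum_(t : T) X)); last first.
  rewrite sumr_const -[X *+ _]mulr_natl.
  apply: (@le_trans _ _ (Ccov / del ^+ d * X)); first by rewrite ler_wpM2r.
  rewrite le_eqVlt; apply/orP; left; apply/eqP.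
  rewrite /X /Cl !exprMn; field; by rewrite expf_neq0// gt_eqF.
apply: ler_sum => t _.
pose S (ij : I * J) := (C ij.1 ij.2 - phi ij.1 - psi ij.2 <= del ^+ 2) && (kk ij == t).
(* Any pair with label [t] serves as the centre of its piece. *)
have [[i0 j0] /andP[/= E0 /eqP k0]|S0] := pickP S; last by rewrite (big_pred0 _ _ _ _ S0).
have near ij : S ij -> `|p ij.1 - p i0| <= K * del /\ `|q ij.2 - q j0| <= K * del.
  case: ij => i j /andP[/= E1 /eqP k1].
  have kE : k (p i, q j) = k (p i0, q j0) by exact: etrans k1 (esym k0).
  have cr : cross c (p i) (q j) (p i0) (q j0) <= 2 * del ^+ 2.
    rewrite (crossE c p q phi psi).
    have := feas i j0; have := feas i0 j; rewrite /C in E0 E1 *; lra.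
  by have [] := hk _ _ _ _ (conj (Xp_ i) (Xq_ j)) (conj (Xp_ i0) (Xq_ j0)) kE cr.
apply: (@le_trans _ _ (\sum_(ij : I * J | (`|p ij.1 - p i0| <= K * del) &&
    (`|q ij.2 - q j0| <= K * del)) a ij.1 * b ij.2)).
  rewrite big_mkcond [leRHS]big_mkcond; apply: ler_sum => ij _.
  have ab0 : 0 <= a ij.1 * b ij.2 by exact: mulr_ge0.
  rewrite -/(S ij).
  by case: ifP => [/near[-> ->]//|_]; case: ifP.
rewrite -(pair_big (fun i => `|p i - p i0| <= K * del) (fun j => `|q j - q j0| <= K * del)
   (fun i j => a i * b j)) /= -big_distrlr /=.
have Kd : K * del + h <= (K + 1) * del by rewrite mulrDl mul1r lerD2l.
have Kd0 : 0 <= K * del by rewrite mulr_ge0// ltW.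
have Kh0 : 0 <= K * del + h by rewrite addr_ge0// ltW.
have Kd1 : 0 <= (K + 1) * del by exact: le_trans Kd.
apply: ler_pM; [by apply: sumr_ge0|by apply: sumr_ge0| |].
  apply: le_trans (mass_near cA Ap mumM h0 Kd0 (i0 := i0) _) _ => //.
  by rewrite ler_wpM2l// lerXn2r// nnegrE.
apply: le_trans (mass_near cB Bq mupM h0 Kd0 (i0 := j0) _) _ => //.
by rewrite ler_wpM2l// lerXn2r// nnegrE.
Qed.

Let C2 := cake_const R d * (Cl + 1).

Lemma partition_function_bound (phi : I -> R) (psi : J -> R) (eps : R) :
  (forall i j, phi i + psi j <= C i j) -> 0 < eps -> h <= Num.sqrt eps ->
  \sum_i \sum_j a i * b j * expR (- (C i j - phi i - psi j) / eps)
    <= C2 * Num.sqrt eps ^+ d.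
Proof.
move=> feas eps0 hs; set se := Num.sqrt eps.
have se0 : 0 < se by rewrite sqrtr_gt0.
have Cl0 : 0 <= Cl.
  have K1 : 0 <= (K + 1) ^+ d by rewrite exprn_ge0// addr_ge0.
  by apply: mulr_ge0 => //; apply: mulr_ge0; apply: mulr_ge0.
rewrite (pair_big xpredT xpredT (fun i j => a i * b j * expR (- (C i j - phi i - psi j) / eps))) /=.
rewrite /C2 -mulrA; apply: layer_cake => //.
- by move=> ij; exact: mulr_ge0.
- by move=> ij; have := feas ij.1 ij.2; rewrite -subr_ge0 opprD addrA.
- by rewrite mulr_ge0 ?addr_ge0// exprn_ge0// ltW.
move=> n; pose del := Num.sqrt (n.+1%:R * eps).
have n1 : 0 < n.+1%:R :> R by rewrite ltr0n.
have delE : del ^+ 2 = n.+1%:R * eps by rewrite sqr_sqrtr// mulr_ge0// ltW.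
have del0 : 0 < del by rewrite sqrtr_gt0 mulr_gt0.
(* [sqrt (n + 1)] is bounded crudely by [n + 1], a growth that [layer_cake] tolerates. *)
have deld : del ^+ d <= se ^+ d * n.+1%:R ^+ d.
  rewrite -exprMn; apply: lerXn2r; rewrite ?nnegrE ?mulr_ge0 ?sqrtr_ge0//.
  rewrite /del sqrtrM ?ler0n// mulrC ler_pM2l//.
  rewrite -[leRHS]ger0_norm ?ler0n// -sqrtr_sqr ler_wsqrtr//.
  by rewrite expr2 ler_peMr// ?ler0n// ler1n.
have hdel : h <= del.
  apply: le_trans hs _; rewrite ler_wsqrtr// ler_peMl ?ler1n//; exact: ltW.
rewrite -delE -mulrA; have [del1|del1] := leP del 1.
  apply: le_trans (level_bound feas _ hdel) _; first by rewrite del0.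
  apply: le_trans (ler_wpM2l Cl0 deld) _; apply: ler_wpM2r; last by rewrite lerDl.
  by rewrite mulr_ge0// exprn_ge0// ltW.
(* Above scale one [level_bound] does not apply, but the total mass one suffices; this accounts for
   the added one in [C2]. *)
have s1 : \sum_(ij : I * J) a ij.1 * b ij.2 = 1.
  rewrite -(pair_big xpredT xpredT (fun i j => a i * b j)) /=.
  under eq_bigr do rewrite -mulr_sumr b1 mulr1.
  exact: a1.
apply: (@le_trans _ _ 1).
  rewrite -s1 big_mkcond; apply: ler_sum => ij _; case: ifP => // _; exact: mulr_ge0.
apply: (@le_trans _ _ (del ^+ d)); first by rewrite exprn_ege1// ltW.
apply: le_trans deld _; rewrite ler_peMl ?lerDr//.
by rewrite mulr_ge0// exprn_ge0// ltW.
Qed.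

Variable eta : R.
Hypothesis eta0 : 0 < eta.
Hypothesis Ceta : forall i j x y, A i x -> B j y -> spt mum x -> spt mup y ->
    `|c x y - C i j| <= eta.

Let cost g : coupling mum mup g ->
  exists2 t : R, transport_cost Om Op c g = t%:E &
    `|t - \sum_i \sum_j mass W g (i, j) * C i j| <= eta.
Proof. by apply: transport_cost_cells => //; exact: ltW. Qed.

(* [V] is the value of the discretised transport problem; [V] and the optimal
   discrete plan control both [v_0] and [v_eps]. *)
Lemma discrete_bounds (eps : R) : 0 < eps < 1 -> h <= Num.sqrt eps ->
  exists V : R, [/\ (v_0 Om Op mum mup c <= (V + eta)%:E)%E,
    ((V - eta)%:E <= v_0 Om Op mum mup c)%E,
    (v_eps Om Op mum mup c eps <= (V + eta + (K + 2) * eps +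
       eps * ln ((Ccov + 1) / Num.sqrt eps ^+ d))%:E)%E &
    ((V - 2 * eta - eps * ln (C2 * Num.sqrt eps ^+ d))%:E <= v_eps Om Op mum mup c eps)%E].
Proof.
move=> /andP[eps0 eps1] hs; set se := Num.sqrt eps.
have se0 : 0 < se by rewrite sqrtr_gt0.
have se1 : se <= 1 by rewrite -sqrtr1 ler_wsqrtr// ltW.
have seE : se ^+ 2 = eps by rewrite sqr_sqrtr// ltW.
have [g gab gmin] := fin_coupling_min C a0 b0 a1 b1.
have [g0 ga gb] := gab.
pose V := \sum_i \sum_j g i j * C i j.
have dual e := @fin_coupling_dual _ _ _ a b C g e gab a1 ^~ gmin.
exists V; split.
- have [P [Pc PM _]] := fin_coupling_lift cA cB gab.
  have [t tE ht] := cost Pc.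
  apply: (@le_trans _ _ t%:E); first by apply: ereal_inf_lbound; exists P.
  move: ht; rewrite lee_fin; under eq_bigr do under eq_bigr do rewrite PM.
  by rewrite -/V ler_norml => /andP[? ?]; lra.
- apply: le_ereal_inf_tmp => _ [P Pc <-]; have [t -> ht] := cost Pc.
  have := gmin _ (coupling_mass cA cB Pc); rewrite lee_fin -/V.
  by move: ht; rewrite ler_norml => /andP[? ?]; lra.
(* [e] is at most every positive weight of the plan. A duality gap of [eps * e] then forces slack at
   most [eps] at every charged pair, since a single weighted slack is at most the gap. *)
- have [e e0 eg] : exists2 e : R, 0 < e & forall i j, 0 < g i j -> e <= g i j.
    exists (\big[Num.min/1]_(ij : I * J | 0 < g ij.1 ij.2) g ij.1 ij.2).
      by apply: lt_bigmin => //; exact: ltr01.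
    by move=> i j gij; exact: (bigmin_le_cond _ (j := (i, j))).
  have [phi [psi [feas Vdual]]] := dual (eps * e) (mulr_gt0 eps0 e0).
  have Vsum : \sum_i a i * phi i + \sum_j b j * psi j <= V.
    rewrite -(fin_coupling_sum phi psi gab); apply: ler_sum => i _; apply: ler_sum => j _.
    by rewrite ler_wpM2l.
  have slack i j : 0 < g i j -> C i j - phi i - psi j <= eps.
    move=> gij; rewrite -(ler_pM2l gij) -/(C i j).
    apply: (@le_trans _ _ (eps * e)); last by rewrite mulrC ler_pM2r// eg.
    apply: (@le_trans _ _ (\sum_i \sum_j g i j * (C i j - phi i - psi j))).
      have t0 i' j' : 0 <= g i' j' * (C i' j' - phi i' - psi j').
        by rewrite mulr_ge0// -addrA -opprD subr_ge0.
      rewrite (bigD1 i)//= (bigD1 j)//= -[leLHS]addr0; apply: lerD.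
        by rewrite -[leLHS]addr0; apply: lerD => //; exact: sumr_ge0.
      by apply: sumr_ge0 => i' _; exact: sumr_ge0.
    rewrite (eq_bigr (fun i => \sum_j g i j * C i j - \sum_j g i j * (phi i + psi j))); last first.
      by move=> i' _; rewrite -sumrB; apply: eq_bigr => j' _; ring.
    by rewrite sumrB (fin_coupling_sum phi psi gab) lerBlDl.
  have [T [k [cT hk]]] : exists (T : finType) (k : 'rV[R]_d * 'rV[R]_d -> T),
      #|T|%:R <= Ccov / se ^+ d /\
      forall x y x' y', (spt mum `*` spt mup) (x, y) -> (spt mum `*` spt mup) (x', y') ->
        k (x, y) = k (x', y') -> cross c x y x' y' <= 2 * se ^+ 2 ->
        [/\ `|x - x'| <= K * se, `|y - y'| <= K * se &
            `|cross c x y x' y'| <= K * se ^+ 2] by apply: cov; rewrite se0.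
  pose kk i j := k (p i, q j); pose g' := glued g kk.
  have g'c : fin_coupling a b g' by exact: glued_coupling.
  have g'cost : \sum_i \sum_j g' i j * C i j <= V + (K + 2) * eps.
    apply: (@le_trans _ _ (\sum_i a i * phi i + \sum_j b j * psi j + (K + 2) * eps)); last first.
      by rewrite lerD2r.
    (* The slacks at the two swapped pairs are nonnegative and sum to at most [2 eps] minus the
       cross difference, hence to at most [(K + 2) eps]. *)
    apply: glued_cost => // i j i' j' gij gij' kij.
    have s1 := slack _ _ gij; have s2 := slack _ _ gij'.
    have f1 := feas i' j.
    have crE := crossE c p q phi psi i j i' j'.
    have cr : cross c (p i) (q j) (p i') (q j') <= 2 * se ^+ 2.
      by rewrite seE crE; have := feas i j'; rewrite /C in s1 s2 f1 *; lra.
    have [_ _] := hk _ _ _ _ (conj (Xp_ i) (Xq_ j)) (conj (Xp_ i') (Xq_ j')) kij cr.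
    by rewrite seE crE ler_norml => /andP[h1 _]; rewrite /C in s1 s2 f1 *; lra.
  have g'ent : \sum_i \sum_j g' i j * ln (g' i j / (a i * b j)) <= ln ((Ccov + 1) / se ^+ d).
    apply: le_trans (glued_entropy kk gab a1) _.
    have T0 : 0 < #|T|%:R :> R.
      rewrite ltr0n; apply/card_gt0P; have [i _] := sum1_pos a0 a1.
      by have [j _] := sum1_pos b0 b1; exists (kk i j).
    rewrite ler_ln ?posrE ?divr_gt0 ?exprn_gt0 ?ltr_wpDl//.
    by apply: le_trans cT _; rewrite ler_pM2r ?invr_gt0 ?exprn_gt0// lerDl.
  have [P [Pc PM Pent]] := fin_coupling_lift cA cB g'c.
  have [t tE ht] := cost Pc.
  apply: (@le_trans _ _ (transport_cost Om Op c P + eps%:E * rel_ent mum mup P)%E).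
    by apply: ereal_inf_lbound; exists P.
  rewrite tE; apply: (@le_trans _ _ (t%:E + eps%:E * (ln ((Ccov + 1) / se ^+ d))%:E)%E).
    rewrite leeD2l// lee_pmul2l//; apply: le_trans Pent _; by rewrite lee_fin.
  rewrite -EFinM -EFinD lee_fin lerD2r.
  move: ht; under eq_bigr do under eq_bigr do rewrite PM.
  by rewrite ler_norml => /andP[? ?]; lra.
(* Duality holds up to an arbitrary gap [e], so the inequality is proved with that error. *)
- apply/lee_addgt0Pr => e e0.
  have [phi [psi [feas Vdual]]] := dual e e0.
  pose Z := \sum_i \sum_j a i * b j * expR (- (C i j - phi i - psi j) / eps).
  have Zb : Z <= C2 * se ^+ d by exact: partition_function_bound.
  have Z0 : 0 < Z.
    have [i ai] := sum1_pos a0 a1; have [j bj] := sum1_pos b0 b1.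
    have t0 i' j' : 0 <= a i' * b j' * expR (- (C i' j' - phi i' - psi j') / eps).
      by rewrite mulr_ge0 ?mulr_ge0// expR_ge0.
    rewrite /Z (bigD1 i)//= ltr_wpDr//.
      by apply: sumr_ge0 => i' _; exact: sumr_ge0.
    rewrite (bigD1 j)//= ltr_wpDr//; first exact: sumr_ge0.
    by rewrite !mulr_gt0// expR_gt0.
  rewrite -leeBlDr// -EFinB; apply: le_ereal_inf_tmp => _ [P Pc <-].
  have [t -> ht] := cost Pc; pose m i j := mass W P (i, j).
  have mc : fin_coupling a b m by exact: coupling_mass.
  (* The log-density of the discrete Gibbs plan, normalised by [Z] so that its exponential has total
     mass one for the product of the marginals. *)
  pose G (ij : I * J) := - (C ij.1 ij.2 - phi ij.1 - psi ij.2) / eps - ln Z.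
  have cW := cells_prod cA cB.
  have entb : ((\sum_ij G ij * mass W P ij)%:E <= rel_ent mum mup P)%E.
    apply: le_ereal_inf_tmp => _ [rho [mrho rho0 rhoE] <-].
    apply: (entropy_ge_cells cW mrho rho0 rhoE).
    rewrite -(pair_big xpredT xpredT (fun i j => expR (G (i, j)) * mass W (mum \x mup)%E (i, j))) /=.
    rewrite le_eqVlt; apply/orP; left; apply/eqP; rewrite -[RHS](divff (lt0r_neq0 Z0)).
    rewrite {1}/Z mulr_suml; apply: eq_bigr => i _; rewrite mulr_suml; apply: eq_bigr => j _.
    rewrite mass_prod// /G /= expRD expRN lnK ?posrE// -/a -/b; ring.
  have GE : \sum_ij G ij * mass W P ij = (\sum_i a i * phi i + \sum_j b j * psi j
      - \sum_i \sum_j m i j * C i j) / eps - ln Z.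
    rewrite -(fin_coupling_sum phi psi mc) -sumrB mulr_suml.
    have -> : ln Z = \sum_i \sum_j m i j * ln Z.
      have [_ ma _] := mc; under eq_bigr do rewrite -mulr_suml ma.
      by rewrite -mulr_suml a1 mul1r.
    rewrite -sumrB -(pair_big xpredT xpredT (fun i j => G (i, j) * mass W P (i, j))) /=.
    apply: eq_bigr => i _; rewrite -sumrB mulr_suml -sumrB; apply: eq_bigr => j _.
    by rewrite /G /m /=; ring.
  apply: (@le_trans _ _ (t%:E + eps%:E * (\sum_ij G ij * mass W P ij)%:E)%E); last first.
    by rewrite leeD2l// lee_pmul2l.
  rewrite -EFinM -EFinD lee_fin GE mulrBr mulrCA divff ?gt_eqF// mulr1.
  have lnZ : eps * ln Z <= eps * ln (C2 * se ^+ d).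
    by rewrite ler_pM2l// ler_ln ?posrE//; exact: lt_le_trans Zb.
  have {ht} : `|t - \sum_i \sum_j m i j * C i j| <= eta by exact: ht.
  rewrite ler_norml => /andP[ht _]; rewrite -/V in Vdual.
  move: ht lnZ Vdual eta0; set Lc := eps * ln (C2 * _); set Lz := eps * ln Z.
  set S := \sum_i \sum_j _; set Phi := \sum_i a i * phi i + _.
  move: Lc Lz S Phi => Lc Lz S Phi h1 h2 h3 h4; lra.
Qed.
End assembly.

Lemma fin_num_between (R : realType) (x : \bar R) (l u : R) :
  (l%:E <= x)%E -> (x <= u%:E)%E -> x \is a fin_num /\ l <= fine x <= u.
Proof. by case: x => [r| |] //=; rewrite !lee_fin => -> ->. Qed.

Theorem theorem1p1 (R : realType) (d : nat)
  (Om Op : set 'rV[R]_d)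
  (mum mup : probability 'rV[R]_d R)
  (c : 'rV[R]_d -> 'rV[R]_d -> R) :
  open Om -> open Op ->
  convex_set (Om : set (convex_lmodType 'rV[R]_d)) ->
  convex_set (Op : set (convex_lmodType 'rV[R]_d)) ->
  abs_cont_Linf mum -> abs_cont_Linf mup ->
  compact (spt mum) -> spt mum `<=` Om ->
  compact (spt mup) -> spt mup `<=` Op ->
  C2_on Om Op c -> inf_twisted Om Op c ->
  exists (C eps0 : R), 0 < eps0 /\
    v_0 Om Op mum mup c \is a fin_num /\
    forall eps : R, 0 < eps < eps0 ->
      v_eps Om Op mum mup c eps \is a fin_num /\
      `| fine (v_eps Om Op mum mup c eps) - fine (v_0 Om Op mum mup c)
         - (d%:R / 2) * eps * ln (1 / eps) | <= C * eps.
Proof.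
move=> oOm oOp _ _ fm fp cXm XmO cXp XpO c2 tw.
have cc : cont_on Om Op c by case: c2 => -[].
have [Ccov [K [Ccov0 K0 cov]]] := coverable_compact oOm oOp c2 tw cXm XmO cXp XpO.
have [Mm Mm0 mumM] := Linf_ball fm; have [Mp Mp0 mupM] := Linf_ball fp.
pose C2 := cake_const R d * (Ccov * (Mm * (K + 1) ^+ d * (Mp * (K + 1) ^+ d)) + 1).
have C20 : 0 < C2.
  have K1 : 0 <= (K + 1) ^+ d by rewrite exprn_ge0// addr_ge0.
  apply: mulr_gt0.
    by rewrite /cake_const !mulr_gt0// ?expR_gt0// exprn_gt0// ltr0n addn2.
  by rewrite ltr_wpDl// !mulr_ge0.
(* The discretisation error [eta] is taken equal to [eps], and the mesh at most [sqrt eps]; [V]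
   varies with [eps] but drops out of the difference [v_eps - v_0]. *)
have main (eps : R) : 0 < eps < 1 -> exists V : R,
   [/\ (v_0 Om Op mum mup c <= (V + eps)%:E)%E,
    ((V - eps)%:E <= v_0 Om Op mum mup c)%E,
    (v_eps Om Op mum mup c eps <= (V + eps + (K + 2) * eps +
       eps * ln ((Ccov + 1) / Num.sqrt eps ^+ d))%:E)%E &
    ((V - 2 * eps - eps * ln (C2 * Num.sqrt eps ^+ d))%:E <= v_eps Om Op mum mup c eps)%E].
  move=> eps01; have /andP[eps0 eps1] := eps01.
  have [h1 h10 Hc] := cost_uniform oOm oOp cc cXm XmO cXp XpO eps0.
  pose h := Num.min h1 (Num.sqrt eps).
  have h0 : 0 < h by rewrite lt_min h10 sqrtr_gt0.
  have hh1 : h <= h1 by rewrite ge_min lexx.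
  have hs : h <= Num.sqrt eps by rewrite ge_min lexx orbT.
  have [n [p [A [cA Xp_ Ap]]]] := spt_partition cXm h0.
  have [m [q [B [cB Xq_ Bq]]]] := spt_partition cXp h0.
  apply: (discrete_bounds oOm oOp cc XmO XpO cA cB Xp_ Xq_ Ap Bq h0 Ccov0 K0 Mm0 Mp0 cov mumM mupM eps0) => //.
  move=> i j x y Ax By Xx Xy; apply: Hc => //.
    by apply: le_ball hh1 _ _; exact: Ap Ax Xx.
  by apply: le_ball hh1 _ _; exact: Bq By Xy.
pose L1 := ln (Ccov + 1); pose L2 := ln C2.
(* The errors without logarithm total at most [(K + 4) eps] above and [3 eps] below; [L1] and [L2]
   are the constant parts of the two logarithms. *)
exists (K + 5 + `|L1| + `|L2|), 1; split => //; split.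
  have [|V [h1 h2 _ _]] := main 2^-1; first by apply/andP; split; lra.
  by have [] := fin_num_between h2 h1.
move=> eps eps01; have [V [h1 h2 h3 h4]] := main _ eps01.
have /andP[eps0 _] := eps01.
have [_ /andP[v1 v2]] := fin_num_between h2 h1.
have [vfin /andP[w1 w2]] := fin_num_between h4 h3.
split => //.
have se0 : 0 < Num.sqrt eps by rewrite sqrtr_gt0.
(* The leading term arises here, from the power [d] of [sqrt eps] inside both logarithms. *)
have lns : ln (Num.sqrt eps ^+ d) = - (d%:R / 2 * ln (1 / eps)).
  have -> : ln (1 / eps) = - (ln (Num.sqrt eps) *+ 2).
    by rewrite div1r lnV ?posrE// -lnXn// sqr_sqrtr// ltW.
  by rewrite lnXn// -mulr_natl -[_ *+ 2]mulr_natl; field.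
have lu : ln ((Ccov + 1) / Num.sqrt eps ^+ d) = L1 + d%:R / 2 * ln (1 / eps).
  by rewrite ln_div ?posrE ?exprn_gt0 ?ltr_wpDl// lns opprK.
have ll : ln (C2 * Num.sqrt eps ^+ d) = L2 - d%:R / 2 * ln (1 / eps).
  by rewrite lnM ?posrE ?exprn_gt0// lns.
move: w1 w2; rewrite lu ll !mulrDr.
have e1 : eps * L1 <= eps * `|L1| by rewrite ler_pM2l// ler_norm.
have e2 : eps * L2 <= eps * `|L2| by rewrite ler_pM2l// ler_norm.
have e3 : 0 <= eps * `|L1| by rewrite mulr_ge0// ltW.
have e4 : 0 <= eps * `|L2| by rewrite mulr_ge0// ltW.
have e5 : 0 <= eps * K by rewrite mulr_ge0// ltW.
have -> : d%:R / 2 * eps * ln (1 / eps) = eps * (d%:R / 2 * ln (1 / eps)) by ring.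
rewrite mulrN.
move: (eps * (d%:R / 2 * _)) => X w1 w2.
by rewrite ler_norml; apply/andP; split; lra.
Qed.
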